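(* There exists a trigonometric series $$\sum_{k=-\infty}^{\infty} C_k e^{ikx}\quad\text{with}\quad \sum_{k=-\infty}^{\infty}|C_k|^q<\infty\ \text{ for all } q>2$$ (with complex coefficients $C_k$, $k\in\mathbb{Z}$) such that for every number $\varepsilon>0$ there is a measurable weight function $\mu:[0,2\pi]\to\mathbb{R}$ with $0<\mu(x)\le 1$ for all $x\in[0,2\pi]$ and $$\left|\{x\in[0,2\pi]:\mu(x)\neq 1\}\right|<\varepsilon,$$ for which the series $\sum_{k=-\infty}^{\infty} C_k e^{ikx}$ is universal in $L^1_\mu[0,2\pi]$ in the usual sense. (The series does not depend on $\varepsilon$; the weight $\mu$ may depend on $\varepsilon$.)
   Context: $|A|$ denotes the Lebesgue measure of a measurable set $A$. For a measurable function $\mu$ on $[0,2\pi]$ with $0<\mu(x)\le 1$, $L^1_\mu[0,2\pi]$ is the Banach space of measurable (complex-valued) functions $f$ on $[0,2\pi]$ (modulo equality a.e.) with $\|f\|=\int_0^{2\pi}|f(x)|\mu(x)\,dx<\infty$. A series of elements of a Banach space $X$ is said to be universal in $X$ in the usual sense if for any $f\in X$ there exists a (strictly) growing sequence of natural numbers $n_1<n_2<\cdots$ such that the sequence of partial sums of the series with numbers $n_k$ converges to $f$ in the norm of $X$. For a series $\sum_{k=-\infty}^\infty C_ke^{ikx}$ indexed by $\mathbb{Z}$, the partial sum with number $n$ is the symmetric sum $\sum_{|k|\le n}C_ke^{ikx}$. *)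

(* Defs.v *)
From HB Require Import structures.
From mathcomp Require Import all_boot all_order all_algebra.
From mathcomp Require Import complex.
From mathcomp Require Import all_classical all_reals all_analysis.

Set Implicit Arguments.
Unset Strict Implicit.
Unset Printing Implicit Defensive.

Import Order.TTheory GRing.Theory Num.Theory.
Import numFieldNormedType.Exports.

Local Open Scope classical_set_scope.
Local Open Scope ring_scope.

(* The real-valued modulus; `|z| : R[i] is not usable under a real integral. *)
Definition cabs (R : realType) (z : R[i]) : R := ComplexField.Normc.normc z.

Definition expix (R : realType) (k : int) (x : R) : R[i] :=
  Complex (cos (k%:~R * x)) (sin (k%:~R * x)).

(* The index k = j - n runs over the integers with |k| <= n. *)
Definition trig_psum (R : realType) (C : int -> R[i]) (n : nat) : R -> R[i] :=
  fun x => \sum_(j < n.*2.+1) C (j%:Z - n%:Z) * expix (j%:Z - n%:Z) x.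

Definition period (R : realType) : set R := `[0, 2 * pi]%classic.

Definition wnorm (R : realType) (mu : R -> R) (f : R -> R[i]) : \bar R :=
  \int[@lebesgue_measure R]_(x in @period R) (cabs (f x) * mu x)%:E.

(* Functions are not quotiented by a.e. equality: the elements are
   representatives, and wnorm is a seminorm on them. Measurability is with
   respect to the Borel sigma-algebra; every Lebesgue measurable function is
   a.e. equal to a Borel one, so the quotient is the usual L^1_mu[0, 2 pi]. *)
Definition wL1 (R : realType) (mu : R -> R) : set (R -> R[i]) :=
  [set f | [/\ measurable_fun (@period R) (fun x => complex.Re (f x)),
               measurable_fun (@period R) (fun x => complex.Im (f x)) &
               (wnorm mu f < +oo)%E]].

(* A series is given by its sequence S of partial sums; it is a series of
   elements of X exactly when all its partial sums lie in the subspace X. *)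
Definition universal_series (R : realType) (V : zmodType) (X : set V)
    (N : V -> \bar R) (S : nat -> V) : Prop :=
  (forall n, X (S n)) /\
  (forall f, X f -> exists n : nat -> nat,
     {homo n : i j / (i < j)%N >-> (i < j)%N} /\
     N (S (n k) - f) @[k --> \oo] --> 0%E).

(* Main.v *)
Require Import Defs.
From HB Require Import structures.
From mathcomp Require Import all_boot all_order all_algebra.
From mathcomp Require Import complex.
From mathcomp Require Import all_classical all_reals all_analysis.
From mathcomp Require Import measurable_realfun.
From mathcomp Require Import zify ring lra.
Import Order.TTheory GRing.Theory Num.Theory.
Import numFieldNormedType.Exports.
Local Open Scope classical_set_scope.
Local Open Scope ring_scope.

(** The series is a sum of blocks P_0, P_1, ... of trigonometric polynomials
    with higher and higher frequencies.  Let g_0, g_1, ... run through the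
    trigonometric polynomials with rational coefficients, each one occurring
    infinitely often.  The block P_n is such that P_0 + ... + P_n differs from
    g_n by at most 2^-(n+1) outside a set of measure less than 2^-(n+1), while
    the sum of the q_n-th powers of the moduli of its coefficients is at most
    2^-(n+1), with q_n > 2 decreasing to 2.  So the coefficients lie in l^q for
    every q > 2.

    The heart of the matter is that such a block exists
    ([approximation_step]): a trigonometric polynomial f can be approximated in
    measure by one with arbitrarily high frequencies and with coefficients
    small in l^q.  Let K_N be proportional to (1 + cos) ^ N and of mean value
    one.  It is negligible at distances from 2 pi Z much larger than
    N ^ (-1/2), its coefficients lie in [0, 1], and its value at 0, which is
    the sum of its coefficients, is of order N ^ (1/2).  Take
      P (x) = f (x) * (1 / M) * sum_(i < M) (1 - K_N (n_i x))
    with n_0, n_1, ... increasing so fast that the functions 1 - K_N (n_i x)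
    have no frequency in common.
    - There is no constant term in 1 - K_N, so the frequencies of P are high if
      n_0 is.
    - P is close to f where all K_N (n_i x) are small.  By Markov's inequality
      the exceptional set has measure of order M / N ^ (1/2), up to a
      logarithmic factor; so N of order M ^ 2, with such a factor, will do.
    - The coefficients of P are of order 1 / M, and their moduli add up to at
      most a multiple of K_N (0), which is of order M up to a logarithmic
      factor.  The sum of their q-th powers is therefore of order M ^ (2 - q),
      again up to such a factor, and tends to 0 because q > 2.

    Universality follows from two further facts.  First, if functions h_n are
    small off sets whose measures have a finite sum, there is a weight, equal
    to 1 off a set of measure less than a given epsilon, for which the h_n tend
    to 0 in the mean: it suffices to make the weight tiny on the n-th
    exceptional set, depending on the size of h_n
    ([weight_of_small_exceptions]).  With h_n = |P_0 + ... + P_n - g_n| this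
    says that the partial sums follow the sequence g_n in the weighted norm.
    Second, the g_n are dense in the weighted space ([ratlist_dense]), so each
    f in it is the limit of a subsequence of g_n, hence of the corresponding
    partial sums. *)

(** * Complex modulus and exponentials *)

Section modulus.
Context {R : realType}.
Implicit Types (z w : R[i]) (x y : R) (k l : int).

Lemma cabs_ge0 z : 0 <= cabs z.
Proof. by case: z => a b; exact: sqrtr_ge0. Qed.

Lemma cabs0 : cabs (0 : R[i]) = 0. Proof. exact: ComplexField.Normc.normc0. Qed.

Lemma cabs1 : cabs (1 : R[i]) = 1. Proof. exact: ComplexField.Normc.normc1. Qed.

Lemma cabsM z w : cabs (z * w) = cabs z * cabs w.
Proof. exact: ComplexField.Normc.normcM. Qed.

Lemma cabsN z : cabs (- z) = cabs z. Proof. exact: normcN. Qed.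

Lemma ler_cabsD z w : cabs (z + w) <= cabs z + cabs w.
Proof. exact: le_normcD. Qed.

Lemma cabs_real x : cabs (x%:C)%C = `|x|.
Proof. by rewrite /cabs /= expr0n addr0 sqrtr_sqr. Qed.

Lemma ler_cabs_sum (I : Type) (s : seq I) (P : pred I) (F : I -> R[i]) :
  cabs (\sum_(i <- s | P i) F i) <= \sum_(i <- s | P i) cabs (F i).
Proof.
elim/big_ind2 : _ => //; first by rewrite cabs0.
by move=> a b c d ab cd; rewrite (le_trans (ler_cabsD _ _))// lerD.
Qed.

Lemma cabs_sqr z : cabs z ^+ 2 = complex.Re z ^+ 2 + complex.Im z ^+ 2.
Proof. by case: z => a b; rewrite /cabs/= sqr_sqrtr// addr_ge0// sqr_ge0. Qed.

Lemma ler_Re_cabs z : `|complex.Re z| <= cabs z.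
Proof.
case: z => a b; rewrite /cabs/= -(sqrtr_sqr a) ler_sqrt ?addr_ge0 ?sqr_ge0//.
by rewrite lerDl sqr_ge0.
Qed.

Lemma ler_Im_cabs z : `|complex.Im z| <= cabs z.
Proof.
case: z => a b; rewrite /cabs/= -(sqrtr_sqr b) ler_sqrt ?addr_ge0 ?sqr_ge0//.
by rewrite lerDr sqr_ge0.
Qed.

Lemma cReD z w : complex.Re (z + w) = complex.Re z + complex.Re w.
Proof. by case: z w => a b [c d]. Qed.

Lemma cImD z w : complex.Im (z + w) = complex.Im z + complex.Im w.
Proof. by case: z w => a b [c d]. Qed.

Lemma cReN z : complex.Re (- z) = - complex.Re z.
Proof. by case: z. Qed.

Lemma cImN z : complex.Im (- z) = - complex.Im z.
Proof. by case: z. Qed.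

Lemma cReM z w : complex.Re (z * w) =
  complex.Re z * complex.Re w - complex.Im z * complex.Im w.
Proof. by case: z w => a b [c d]. Qed.

Lemma cImM z w : complex.Im (z * w) =
  complex.Re z * complex.Im w + complex.Im z * complex.Re w.
Proof. by case: z w => a b [c d]. Qed.

Lemma cRe_sum (I : Type) (s : seq I) (P : pred I) (F : I -> R[i]) :
  complex.Re (\sum_(i <- s | P i) F i) = \sum_(i <- s | P i) complex.Re (F i).
Proof. by apply: big_morph => //; exact: cReD. Qed.

Lemma cIm_sum (I : Type) (s : seq I) (P : pred I) (F : I -> R[i]) :
  complex.Im (\sum_(i <- s | P i) F i) = \sum_(i <- s | P i) complex.Im (F i).
Proof. by apply: big_morph => //; exact: cImD. Qed.

Lemma cabs_expix k x : cabs (expix k x) = 1.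
Proof. by rewrite /cabs /= cos2Dsin2 sqrtr1. Qed.

Lemma expixD k l x : expix (k + l) x = expix k x * expix l x.
Proof.
rewrite /expix intrD mulrDl cosD sinD; apply/eqP; rewrite eq_complex /=.
by rewrite eqxx /= addrC [X in _ + X]mulrC [X in X + _]mulrC [X in X + _]mulrC.
Qed.

Lemma expix0 x : expix 0 x = 1.
Proof. by rewrite /expix mul0r cos0 sin0. Qed.

Lemma expixM k l x : expix (k * l) x = expix l (k%:~R * x).
Proof. by rewrite /expix intrM mulrAC [_ * l%:~R]mulrC mulrA. Qed.

Lemma expixX n x : expix 1 x ^+ n = expix n%:Z x.
Proof.
by elim: n => [|n IH]; rewrite ?expr0 ?expix0// exprS IH -expixD intS.
Qed.

End modulus.

(** * Trigonometric polynomials as lists *)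

(** A trigonometric polynomial is coded by a list of pairs (coefficient,
    frequency), repeated frequencies being allowed: products and sums are then
    operations on lists, and the bounds on Fourier coefficients become bounds
    on sums over lists. *)
Definition trig {R : realType} (s : seq (R[i] * int)) (x : R) : R[i] :=
  \sum_(p <- s) p.1 * expix p.2 x.

Definition coef {R : realType} (s : seq (R[i] * int)) (k : int) : R[i] :=
  \sum_(p <- s | p.2 == k) p.1.

(** The norm of the Wiener algebra, except that equal frequencies are not
    merged: it bounds both the supremum norm and the l^1 norm of the
    coefficients. *)
Definition wiener {R : realType} (s : seq (R[i] * int)) : R :=
  \sum_(p <- s) cabs p.1.

Definition trig_scale {R : realType} (c : R[i]) (s : seq (R[i] * int)) :=
  [seq (c * p.1, p.2) | p <- s].

Definition trig_mul {R : realType} (s t : seq (R[i] * int)) :=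
  [seq (p.1 * q.1, p.2 + q.2) | p <- s, q <- t].

Section trig_lists.
Context {R : realType}.
Implicit Types (s t : seq (R[i] * int)) (x : R).

Lemma trig_cat s t x : trig (s ++ t) x = trig s x + trig t x.
Proof. exact: big_cat. Qed.

Lemma trig_scaleE c s x : trig (trig_scale c s) x = c * trig s x.
Proof.
rewrite /trig /trig_scale big_map /= mulr_sumr.
by apply: eq_bigr => p _; rewrite mulrA.
Qed.

Lemma trig_mulE s t x : trig (trig_mul s t) x = trig s x * trig t x.
Proof.
rewrite /trig /trig_mul big_allpairs_dep mulr_suml; apply: eq_bigr => p _.
rewrite mulr_sumr; apply: eq_bigr => q _.
by rewrite /= expixD mulrACA.
Qed.

Lemma trig_const c x : trig [:: (c, 0)] x = c.
Proof. by rewrite /trig big_seq1 expix0 mulr1. Qed.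

Lemma wiener_ge0 s : 0 <= wiener s.
Proof. by apply: sumr_ge0 => p _; exact: cabs_ge0. Qed.

Lemma cabs_trig_le s x : cabs (trig s x) <= wiener s.
Proof.
rewrite (le_trans (ler_cabs_sum _ _ _ _))//.
by apply: ler_sum => p _; rewrite cabsM cabs_expix mulr1.
Qed.

Lemma coef_cat s t k : coef (s ++ t) k = coef s k + coef t k.
Proof. exact: big_cat. Qed.

Lemma coef_eq0 s k : (forall p, p \in s -> p.2 != k) -> coef s k = 0.
Proof.
move=> sk; rewrite /coef big_seq_cond big1// => p /andP[/sk].
by case: eqP.
Qed.

Lemma trig_psumE (C : int -> R[i]) n x :
  trig_psum C n x =
  trig [seq (C (j%:Z - n%:Z), j%:Z - n%:Z) | j <- iota 0 n.*2.+1] x.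
Proof.
rewrite /trig_psum /trig big_map /=.
by rewrite -(big_mkord xpredT (fun j => C (j%:Z - n%:Z) * expix (j%:Z - n%:Z) x)).
Qed.

Lemma trig_psum_coef s n x : (forall p, p \in s -> (`|p.2| <= n)%N) ->
  trig_psum (coef s) n x = trig s x.
Proof.
move=> sn; rewrite /trig_psum /trig.
under eq_bigr do rewrite /coef mulr_suml.
rewrite (exchange_big_dep xpredT)//= big_seq [RHS]big_seq.
apply: eq_bigr => p /sn pn.
have kn : (`|(p.2 + n%:Z)%R| < n.*2.+1)%N by lia.
have kE : `|(p.2 + n%:Z)%R|%N%:Z - n%:Z = p.2 by lia.
rewrite (bigD1 (Ordinal kn)) /= ?kE// big1 ?addr0// => j /andP[/eqP pj].
by move=> /negP; case; apply/eqP/val_inj => /=; lia.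
Qed.

Lemma eq_trig_psum (C C' : int -> R[i]) n :
  (forall k, (`|k| <= n)%N -> C k = C' k) -> trig_psum C n = trig_psum C' n.
Proof.
move=> CC'; apply/funext => x; apply: eq_bigr => j _; rewrite CC'//.
by have := ltn_ord j; lia.
Qed.

End trig_lists.

(** * Central binomial coefficients *)

Lemma central_binS N :
  (N.+1 * 'C(N.+1.*2, N.+1) = 2 * (N.*2.+1) * 'C(N.*2, N))%N.
Proof.
have h1 := mul_bin_diag N.*2.+2 N; have h2 := mul_bin_diag N.*2.+1 N.
have h3 : 'C(N.*2.+1, N) = 'C(N.*2.+1, N.+1).
  by rewrite -bin_sub; [congr ('C(_, _)); lia|lia].
by rewrite doubleS; move: h1 h2; rewrite /= h3; nia.
Qed.

(** Both bounds say that 'C(2N, N) / 4 ^ N is of order N ^ (-1/2); they are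
    squared in order to stay within the natural numbers. *)
Lemma central_bin_sqr_le N : ('C(N.*2, N) ^ 2 * N.*2.+1 <= 16 ^ N)%N.
Proof.
elim: N => [|N IH] //.
have := central_binS N; set a := 'C(_, _); set b := 'C(_, _) in IH *.
move=> e; rewrite [leqRHS]expnS -(leq_pmul2l (ltn0Sn N)) -(leq_pmul2l (ltn0Sn N)).
have -> : (N.+1 * (N.+1 * (a ^ 2 * N.+1.*2.+1)) = (N.+1 * a) ^ 2 * N.+1.*2.+1)%N.
  by lia.
rewrite e.
have -> : ((2 * N.*2.+1 * b) ^ 2 * N.+1.*2.+1 =
           (b ^ 2 * N.*2.+1) * (4 * N.*2.+1 * N.+1.*2.+1))%N by lia.
apply: (leq_trans (leq_mul IH (leqnn _))).
have -> : (N.+1 * (N.+1 * (16 * 16 ^ N)) = 16 ^ N * (16 * N.+1 * N.+1))%N by lia.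
by apply: leq_mul => //; lia.
Qed.

Lemma central_bin_sqr_ge N : (0 < N)%N -> (16 ^ N <= 'C(N.*2, N) ^ 2 * (4 * N))%N.
Proof.
case: N => // N _; elim: N => [|N IH] //.
have := central_binS N.+1; set a := 'C(_, _); set b := 'C(_, _) in IH *.
move=> e; rewrite [leqLHS]expnS -(leq_pmul2l (ltn0Sn N.+1)) -(leq_pmul2l (ltn0Sn N.+1)).
have -> : (N.+2 * (N.+2 * (a ^ 2 * (4 * N.+2))) = (N.+2 * a) ^ 2 * (4 * N.+2))%N.
  by lia.
rewrite e.
have -> : (N.+2 * (N.+2 * (16 * 16 ^ N.+1)) = 16 ^ N.+1 * (16 * N.+2 * N.+2))%N by lia.
apply: (leq_trans (leq_mul IH (leqnn _))).
have -> : (b ^ 2 * (4 * N.+1) * (16 * N.+2 * N.+2) =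
  b ^ 2 * (4 * N.+1 * 16 * N.+2 * N.+2))%N by lia.
have -> : ((2 * N.+1.*2.+1 * b) ^ 2 * (4 * N.+2) =
  b ^ 2 * (2 * N.+1.*2.+1 * (2 * N.+1.*2.+1) * (4 * N.+2)))%N by lia.
by apply: leq_mul => //; lia.
Qed.

Lemma bin_le_central N l : ('C(N.*2, l) <= 'C(N.*2, N))%N.
Proof.
wlog lN : l / (l <= N)%N.
  move=> h; have [/h//|Nl] := leqP l N.
  have [l2|l2] := leqP l N.*2; last by rewrite bin_small.
  by rewrite -bin_sub// h//; lia.
rewrite -(subKn lN); elim: (N - l)%N => [|j IH]; first by rewrite subn0.
have [jN|jN] := ltnP j N; last by move: IH; rewrite !(eqP jN) (eqP (leqW jN)).
apply: leq_trans IH; have e : (N - j = (N - j.+1).+1)%N by lia.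
have := mul_bin_left N.*2 (N - j.+1); rewrite -e => h.
by rewrite -(leq_pmul2l (_ : 0 < N - j)%N) ?subn_gt0// h leq_mul2r; apply/orP; right; lia.
Qed.

(** For N = r ^ 2 the square roots can be extracted. *)
Lemma central_bin_sqr_exp_le r : ('C((r ^ 2).*2, r ^ 2) * r <= 4 ^ (r ^ 2))%N.
Proof.
have e : ((4 ^ (r ^ 2)) ^ 2 = 16 ^ (r ^ 2))%N by rewrite -expnM mulnC expnM.
rewrite -leq_sqr e expnMn.
by apply: leq_trans (central_bin_sqr_le _); apply: leq_mul => //; lia.
Qed.

Lemma central_bin_sqr_exp_ge r : (0 < r)%N ->
  (4 ^ (r ^ 2) <= 'C((r ^ 2).*2, r ^ 2) * (2 * r))%N.
Proof.
have e : ((4 ^ (r ^ 2)) ^ 2 = 16 ^ (r ^ 2))%N by rewrite -expnM mulnC expnM.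
move=> r0; rewrite -leq_sqr e expnMn [((2 * r) ^ 2)%N]expnMn.
by apply: central_bin_sqr_ge; rewrite expn_gt0 r0.
Qed.

(** * Powers of the raised cosine *)
Section kernel.
Context {R : realType}.
Implicit Types (x : R) (n N : nat).

(** The powers of this function serve as kernels because both their
    concentration and their Fourier coefficients, which are binomial
    coefficients, are explicit. *)
Definition cosbump n x : R := (1 + cos (n%:R * x)) / 2.

Lemma cosbump_ge0 n x : 0 <= cosbump n x.
Proof. by rewrite /cosbump; have := cos_geN1 (n%:R * x); lra. Qed.

(** The left-hand side is (1 + e^iy) ^ (2 N) e^(- i N y) with y = n x, and
    (1 + e^iy) ^ 2 e^(- i y) = 2 + 2 cos y. *)
Lemma sum_bin_expix n N x :
  \sum_(l < N.*2.+1) 'C(N.*2, l)%:R * expix (n%:Z * (l%:Z - N%:Z)) x =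
  ((4 ^+ N * cosbump n x ^+ N)%:C)%C.
Proof.
set y : R := n%:R * x.
under eq_bigr do rewrite expixM -[n%:Z%:~R]/(n%:R) -/y expixD mulrA.
rewrite -mulr_suml.
have -> : \sum_(l < N.*2.+1) 'C(N.*2, l)%:R * expix l%:Z y =
    (1 + expix 1 y) ^+ N.*2.
  by rewrite exprDn; apply: eq_bigr => l _; rewrite expr1n mul1r expixX mulr_natl.
have -> : expix (- N%:Z) y = expix (-1) y ^+ N.
  elim: N => [|N IH]; first by rewrite expr0 oppr0 expix0.
  by rewrite exprS -IH -expixD intS opprD.
rewrite -muln2 mulnC exprM -exprMn -exprMn rmorphXn; congr (_ ^+ _).
have e1 : expix 1 y * expix (-1) y = 1 by rewrite -expixD subrr expix0.
have -> : (1 + expix 1 y) ^+ 2 * expix (-1) y = 2 + (expix 1 y + expix (-1) y).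
  set a := expix 1 y in e1 *; set b := expix (-1) y in e1 *.
  have -> : (1 + a) ^+ 2 * b = b + 2 * (a * b) + a * (a * b) by ring.
  by rewrite e1; ring.
rewrite /expix /cosbump -/y mul1r mulN1r cosN sinN.
apply/eqP; rewrite eq_complex /=; apply/andP; split; apply/eqP.
  by rewrite /=; field.
by rewrite subrr; ring.
Qed.

Lemma sum_bin_cos n N x :
  \sum_(l < N.*2.+1) 'C(N.*2, l)%:R * cos (n%:R * (l%:R - N%:R) * x) =
  4 ^+ N * cosbump n x ^+ N.
Proof.
have /(congr1 (@complex.Re R)) /= := sum_bin_expix n N x.
rewrite cRe_sum => <-; apply: eq_bigr => l _.
rewrite cReM /expix /=.
have -> : 'C(N.*2, l)%:R = ('C(N.*2, l)%:R%:C)%C :> R[i] by rewrite rmorph_nat.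
by rewrite /= mul0r subr0 intrM intrB.
Qed.

End kernel.

(** * Integrals and measurability *)
Section trig_integrals.
Context {R : realType}.
Implicit Types (x : R) (n N : nat) (k : int) (D : set R).

Lemma measurable_period : measurable (@period R).
Proof. exact: measurable_itv. Qed.

Lemma lebesgue_period : lebesgue_measure (@period R) = (2 * pi)%:E.
Proof.
rewrite /period lebesgue_measure_itv /= lte_fin sube0 ifT//.
by rewrite mulr_gt0// pi_gt0.
Qed.

Lemma measurable_cosM (c : R) D : measurable_fun D (fun x => cos (c * x)).
Proof.
apply: measurable_funTS; apply: continuous_measurable_fun => x.
apply: (@continuous_comp _ _ _ (fun x => c * x) (@cos R)).
  exact: mulrl_continuous.
exact: continuous_cos.
Qed.

Lemma measurable_sinM (c : R) D : measurable_fun D (fun x => sin (c * x)).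
Proof.
apply: measurable_funTS; apply: continuous_measurable_fun => x.
apply: (@continuous_comp _ _ _ (fun x => c * x) (@sin R)).
  exact: mulrl_continuous.
exact: continuous_sin.
Qed.

Lemma sin_int_2pi k : sin (k%:~R * (2 * pi)) = 0 :> R.
Proof.
have h n : sin (n%:R * (2 * pi)) = 0 :> R.
  have -> : n%:R * (2 * pi) = 0 + (pi *+ 2) *+ n :> R.
    by rewrite add0r -[pi *+ 2]mulr_natl -[RHS]mulr_natl.
  by rewrite (periodicn (@sinD2pi R)) sin0.
case: k => n; first by rewrite -pmulrn h.
by rewrite NegzE mulrNz -pmulrn mulNr sinN h oppr0.
Qed.

Lemma integral_cos_int k : k != 0 ->
  (\int[@lebesgue_measure R]_(x in @period R) (cos (k%:~R * x))%:E = 0)%E.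
Proof.
move=> k0; have c0 : k%:~R != 0 :> R by rewrite intr_eq0.
set c : R := k%:~R in c0 *.
have cM (x : R) : is_derive x 1 (fun y : R => sin (c * y) / c) (cos (c * x)).
  have d : is_derive x 1 (fun y : R => c * y) c.
    have := @is_deriveZ R R R (@id R) c x 1 1 (@is_derive_id _ _ _ _).
    rewrite /GRing.scale/= mulr1. exact.
  have d2 : is_derive x 1 (fun y : R => sin (c * y)) (c * cos (c * x)).
    rewrite [c * cos _]mulrC.
    exact: (@is_derive1_comp R (@sin R) (fun y => c * y)).
  have -> : (fun y => sin (c * y) / c) = (c^-1 \*: (fun y => sin (c * y))).
    by apply/funext => y /=; rewrite /GRing.scale /= mulrC.
  have := @is_deriveZ R R R (fun y : R => sin (c * y)) c^-1 x 1 _ d2.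
  by rewrite /GRing.scale/= mulKf.
rewrite /period (@continuous_FTC2 _ _ (fun y => sin (c * y) / c)).
- by rewrite sin_int_2pi mulr0 sin0 !mul0r subee.
- by rewrite mulr_gt0// pi_gt0.
- apply: continuous_subspaceT => x.
  apply: (@continuous_comp _ _ _ (fun x => c * x) (@cos R)).
    exact: mulrl_continuous.
  exact: continuous_cos.
- have cs : continuous (fun y : R => sin (c * y) / c).
    by move=> x; apply: differentiable_continuous; apply/derivable1_diffP; case: (cM x).
  split.
  + by move=> x _; case: (cM x).
  + by apply: cvg_at_right_filter; exact: cs.
  + by apply: cvg_at_left_filter; exact: cs.
- by move=> x _; rewrite derive1E; apply: derive_val.
Qed.

Lemma measurable_cosbumpX n N D :
  measurable_fun D (fun x : R => cosbump n x ^+ N).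
Proof.
apply: measurable_funX; rewrite /cosbump.
apply: measurable_funM => //; apply: measurable_funD => //.
exact: measurable_cosM.
Qed.

Lemma integral_cosbumpX n N : (0 < n)%N ->
  (\int[@lebesgue_measure R]_(x in @period R) (cosbump n x ^+ N)%:E =
   ('C(N.*2, N)%:R / 4 ^+ N * (2 * pi))%:E)%E.
Proof.
move=> n0.
pose f (l : 'I_N.*2.+1) (x : R) :=
  (('C(N.*2, l)%:R / 4 ^+ N)%R%:E * (cos ((n%:Z * (l%:Z - N%:Z))%:~R * x)%R)%:E)%E.
have f_int k : (@lebesgue_measure R).-integrable (@period R)
    (fun x => (cos (k%:~R * x))%:E).
  apply: continuous_compact_integrable; first exact: segment_compact.
  apply: continuous_subspaceT => x.
  apply: (@continuous_comp _ _ _ (fun x => k%:~R * x) (@cos R)).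
    exact: mulrl_continuous.
  exact: continuous_cos.
transitivity (\int[@lebesgue_measure R]_(x in @period R)
    (\sum_(l < N.*2.+1) f l x))%E.
  apply: eq_integral => x _; rewrite /f; under eq_bigr do rewrite -EFinM.
  rewrite sumEFin; congr EFin.
  have e4 : (4 : R) ^+ N != 0 by rewrite expf_eq0 pnatr_eq0 andbF.
  apply: (mulfI e4); rewrite -sum_bin_cos mulr_sumr; apply: eq_bigr => l _.
  rewrite intrM intrB -!pmulrn mulrA; congr (_ * _).
  by rewrite mulrCA divff// mulr1.
rewrite integral_sum; first last.
- by move=> l; apply: integrableZl => //; exact: measurable_period.
- exact: measurable_period.
have Nl : (N < N.*2.+1)%N by lia.
rewrite (bigD1 (Ordinal Nl))//= big1 ?adde0 /f.
  rewrite integralZl//; last exact: measurable_period.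
  rewrite subrr mulr0; under eq_integral do rewrite mul0r cos0.
  rewrite integral_cst; last exact: measurable_period.
  by rewrite mul1e [RHS]EFinM; congr (_ * _)%E; exact: lebesgue_period.
move=> l /eqP lN; rewrite integralZl//; last exact: measurable_period.
rewrite integral_cos_int ?mule0//; apply/eqP => /eqP.
rewrite mulf_eq0 subr_eq0 => /orP[/eqP|/eqP[lNE]]; first by lia.
by apply: lN; exact: val_inj.
Qed.

(** Markov's inequality: the N-th power of the bump, N = r ^ 2, has integral of
    order 1 / r, whatever the dilation n. *)
Lemma cosbump_large_measure n r : (0 < n)%N -> (0 < r)%N ->
  (lebesgue_measure (@period R `&` [set x | 2^-1 <= cosbump n x ^+ (r ^ 2)%N]%R)
   <= (4 * pi / r%:R)%:E)%E.
Proof.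
move=> n0 r0; set N := (r ^ 2)%N.
have mf : measurable_fun (@period R) (fun x => (cosbump n x ^+ N)%:E).
  by apply/measurable_EFinP; exact: measurable_cosbumpX.
have h2 : (0 < 2^-1 :> R) by rewrite invr_gt0.
have := le_integral_abse (@lebesgue_measure R) measurable_period mf h2.
have absE x : (`|(cosbump n x ^+ N)%:E| = (cosbump n x ^+ N)%:E)%E.
  by rewrite gee0_abs// lee_fin exprn_ge0// cosbump_ge0.
under eq_integral do rewrite absE.
rewrite integral_cosbumpX//.
under [X in (_ * lebesgue_measure (_ `&` X) <= _)%E]eq_set do rewrite absE lee_fin.
set A := lebesgue_measure _ => hA.
have : (A <= (2 * ('C(N.*2, N)%:R / 4 ^+ N * (2 * pi)))%:E)%E.
  by rewrite EFinM -lee_pdivrMl.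
move/le_trans; apply; rewrite lee_fin.
have -> : 2 * ('C(N.*2, N)%:R / 4 ^+ N * (2 * pi)) =
  4 * pi * ('C(N.*2, N)%:R / 4 ^+ N) :> R by ring.
rewrite ler_pM2l ?mulr_gt0 ?pi_gt0//.
rewrite ler_pdivrMr ?exprn_gt0// mulrC ler_pdivlMr ?ltr0n//.
by rewrite -natrX -natrM ler_nat central_bin_sqr_exp_le.
Qed.

Lemma measurable_gt (f : R -> R) (c : R) D : measurable D ->
  measurable_fun D f -> measurable (D `&` [set x | c < f x]).
Proof. by move=> mD mf; rewrite -preimage_itvoy; exact: mf. Qed.

Lemma measurable_Re_trig (s : seq (R[i] * int)) D :
  measurable_fun D (fun x => complex.Re (trig s x)).
Proof.
rewrite /trig; under eq_fun do rewrite cRe_sum.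
apply: measurable_sum => p; under eq_fun do rewrite cReM /expix /=.
by apply: measurable_funB; apply: measurable_funM => //;
  [exact: measurable_cosM|exact: measurable_sinM].
Qed.

Lemma measurable_Im_trig (s : seq (R[i] * int)) D :
  measurable_fun D (fun x => complex.Im (trig s x)).
Proof.
rewrite /trig; under eq_fun do rewrite cIm_sum.
apply: measurable_sum => p; under eq_fun do rewrite cImM /expix /=.
by apply: measurable_funD; apply: measurable_funM => //;
  [exact: measurable_sinM|exact: measurable_cosM].
Qed.

Lemma measurable_cabs (f : R -> R[i]) D :
  measurable_fun D (fun x => complex.Re (f x)) ->
  measurable_fun D (fun x => complex.Im (f x)) ->
  measurable_fun D (fun x => cabs (f x)).
Proof.
move=> mr mi.
have -> : (fun x => cabs (f x)) =
    (fun x => Num.sqrt (complex.Re (f x) ^+ 2 + complex.Im (f x) ^+ 2)).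
  by apply/funext => x; rewrite /cabs; case: (f x).
apply: (measurableT_comp (f := @Num.sqrt R)).
  exact: continuous_measurable_fun (@sqrt_continuous R).
by apply: measurable_funD; exact: measurable_funX.
Qed.

Lemma measurable_cabs_trig (s : seq (R[i] * int)) D :
  measurable_fun D (fun x => cabs (trig s x)).
Proof.
by apply: measurable_cabs; [exact: measurable_Re_trig|exact: measurable_Im_trig].
Qed.

End trig_integrals.

(** * Coefficient bounds *)
Section coefficient_bounds.
Context {R : realType}.
Implicit Types (s t : seq (R[i] * int)) (k : int) (X : seq int).

Lemma wiener_mul s t : wiener (trig_mul s t) = wiener s * wiener t.
Proof.
rewrite /wiener /trig_mul big_allpairs_dep mulr_suml; apply: eq_bigr => p _.
by rewrite mulr_sumr; apply: eq_bigr => q _; rewrite cabsM.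
Qed.

Lemma wiener_scale c s : wiener (trig_scale c s) = cabs c * wiener s.
Proof.
rewrite /wiener /trig_scale big_map mulr_sumr.
by apply: eq_bigr => p _; rewrite cabsM.
Qed.

Lemma cabs_coef_le s k : cabs (coef s k) <= \sum_(p <- s | p.2 == k) cabs p.1.
Proof. exact: ler_cabs_sum. Qed.

Lemma sum_freq_le s k (B : R) : 0 <= B ->
  uniq [seq p.2 | p <- s] -> (forall p, p \in s -> cabs p.1 <= B) ->
  \sum_(p <- s | p.2 == k) cabs p.1 <= B.
Proof.
move=> B0; elim: s => [|p s IH] /=; first by rewrite big_nil.
move=> /andP[ps us] sB; rewrite big_cons; case: ifPn => [/eqP pk|_]; last first.
  by apply: IH => // p' p's; apply: sB; rewrite in_cons p's orbT.
rewrite big_seq_cond big1 ?addr0 ?sB ?mem_head// => p' /andP[p's /eqP p'k].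
by move: ps; rewrite pk -p'k; move/mapP; case; exists p'.
Qed.

(** Convolution with a polynomial without repeated frequencies: each
    coefficient of the product meets each term of t at most once. *)
Lemma cabs_coef_mul_le s t k (B : R) : 0 <= B ->
  uniq [seq p.2 | p <- s] -> (forall p, p \in s -> cabs p.1 <= B) ->
  cabs (coef (trig_mul s t) k) <= B * wiener t.
Proof.
move=> B0 us sB; apply: (le_trans (cabs_coef_le _ _)).
rewrite /trig_mul big_mkcond big_allpairs_dep exchange_big /= mulr_sumr.
apply: ler_sum => q _.
apply: (@le_trans _ _ (\sum_(p <- s | p.2 == k - q.2) cabs p.1 * cabs q.1)).
  rewrite [leRHS]big_mkcond; apply: ler_sum => p _; rewrite cabsM.
  have -> : (p.2 == k - q.2) = (p.2 + q.2 == k) by rewrite eq_sym subr_eq eq_sym.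
  by case: ifP.
by rewrite -mulr_suml ler_wpM2r ?cabs_ge0// sum_freq_le.
Qed.

Lemma sum_cabs_coef_le s X : uniq X ->
  \sum_(k <- X) cabs (coef s k) <= wiener s.
Proof.
move=> uX.
apply: (@le_trans _ _ (\sum_(k <- X) \sum_(p <- s | p.2 == k) cabs p.1)).
  by apply: ler_sum => k _; exact: cabs_coef_le.
rewrite (exchange_big_dep xpredT)//=; apply: ler_sum => p _.
rewrite -big_filter.
have [/eqP h|/eqP h] := boolP ([seq k <- X | p.2 == k] == [::]).
  by rewrite h big_nil cabs_ge0.
suff -> : [seq k <- X | p.2 == k] = [:: p.2] by rewrite big_seq1.
have : uniq [seq k <- X | p.2 == k] by exact: filter_uniq.
have : all (pred1 p.2) [seq k <- X | p.2 == k].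
  by apply/allP => k; rewrite mem_filter /= eq_sym => /andP[].
case: [seq k <- X | p.2 == k] h => // a [|b l] _ /=.
  by move=> /andP[/eqP ->].
by move=> /and3P[/eqP -> /eqP -> _]; rewrite in_cons eqxx.
Qed.

(** The interpolation of l^q between l^1 and l^infinity. *)
Lemma sum_powR_coef_le s X (B q : R) : uniq X -> 1 <= q ->
  (forall k, cabs (coef s k) <= B) ->
  \sum_(k <- X) cabs (coef s k) `^ q <= B `^ (q - 1) * wiener s.
Proof.
move=> uX q1 sB.
have B0 : 0 <= B by rewrite (le_trans (cabs_ge0 _) (sB 0)).
rewrite (@le_trans _ _ (\sum_(k <- X) B `^ (q - 1) * cabs (coef s k)))//.
  apply: ler_sum => k _; have c0 := cabs_ge0 (coef s k).
  have q0 : (q - 1 + 1 == 0) ==> (cabs (coef s k) != 0).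
    by rewrite subrK gt_eqF// (lt_le_trans ltr01).
  rewrite -[q in leLHS](subrK 1) (powRD q0) powRr1// ler_wpM2r// ge0_ler_powR// ?subr_ge0 ?nnegrE//.
by rewrite -mulr_sumr ler_wpM2l ?powR_ge0// sum_cabs_coef_le.
Qed.

End coefficient_bounds.

(** * The averaged multiplier *)
Section multiplier.
Context {R : realType}.
Implicit Types (x : R) (n N M H i l : nat).

(** With ratio 2 N + 1 the products lacunary i * l, 0 < |l| <= N, are distinct:
    an equality of two of them with i < j would make |l| at least 2 N + 1. *)
Definition lacunary N H i : nat := (H * (N.*2.+1) ^ i)%N.

(** The constant term of the kernel has index l = N. *)
Definition sidelobes N := [seq l <- iota 0 N.*2.+1 | l != N].

#[local] Arguments sidelobes : simpl never.

Lemma mem_sidelobes N l : (l \in sidelobes N) = (l != N) && (l < N.*2.+1)%N.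
Proof. by rewrite mem_filter mem_iota. Qed.

(** The average of K_N (n_i x) - 1 over M lacunary dilations n_i. *)
Definition multiplier M N H : seq (R[i] * int) :=
  [seq (('C(N.*2, l)%:R / 'C(N.*2, N)%:R / M%:R)%:C%C,
        (lacunary N H i)%:Z * (l%:Z - N%:Z))
   | i <- iota 0 M, l <- sidelobes N].

Lemma multiplier_freq_uniq M N H : (0 < H)%N ->
  uniq [seq p.2 | p <- multiplier M N H].
Proof.
move=> H0; rewrite map_allpairs.
apply: allpairs_uniq; [exact: iota_uniq|exact/filter_uniq/iota_uniq|].
move=> [i l] [j l'] /allpairsP[[i1 l1] /= [_ + [-> ->]]].
rewrite mem_sidelobes => /andP[lN lN2].
move=> /allpairsP[[i2 l2] /= [_ + [-> ->]]].
rewrite mem_sidelobes => /andP[l'N l'N2].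
rewrite /lacunary !PoszM -!mulrA => /mulfI h.
have {}h := h ltac:(by rewrite -lt0n).
have b0 k : ((N.*2.+1 ^ k)%N%:Z != 0) by rewrite eqz_nat expn_eq0.
have [ij|ij|ij] := ltngtP i1 i2.
- exfalso; move: h; rewrite -(subnKC (ltnW ij)) expnD PoszM -mulrA => /(mulfI (b0 _)).
  have : (N.*2.+1 <= N.*2.+1 ^ (i2 - i1))%N by rewrite -[leqLHS]expn1 leq_exp2l ?subn_gt0//; lia.
  by set c := expn _ _; move=> bc; nia.
- exfalso; move: h; rewrite -(subnKC (ltnW ij)) expnD PoszM -mulrA => /(mulfI (b0 _)).
  have : (N.*2.+1 <= N.*2.+1 ^ (i1 - i2))%N by rewrite -[leqLHS]expn1 leq_exp2l ?subn_gt0//; lia.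
  by set c := expn _ _; move=> bc; nia.
- move: h; rewrite ij => /(mulfI (b0 _)) h.
  by congr (_, _); lia.
Qed.

Lemma multiplier_freq_ge M N H p : (0 < H)%N ->
  p \in multiplier M N H -> (H <= `|p.2|)%N.
Proof.
move=> H0 /allpairsP[[i l] /= [_ + ->]] /=.
rewrite mem_sidelobes => /andP[lN _]; rewrite /lacunary.
have : (0 < N.*2.+1 ^ i)%N by rewrite expn_gt0.
rewrite abszM absz_nat => b0.
apply: leq_trans (leq_pmulr _ _); last by lia.
exact: leq_pmulr.
Qed.

Lemma central_bin_gt0 N : 0 < 'C(N.*2, N)%:R :> R.
Proof. by rewrite ltr0n bin_gt0 -addnn leq_addr. Qed.

Lemma multiplier_coef_le M N H p : (0 < M)%N ->
  p \in multiplier M N H -> cabs p.1 <= M%:R^-1.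
Proof.
move=> M0 /allpairsP[[i l] [_ + ->]]; rewrite /fst /snd mem_sidelobes => /andP[lN lN2].
rewrite cabs_real ger0_norm; last by rewrite !mulr_ge0 ?invr_ge0.
rewrite ler_piMl ?invr_ge0// ler_pdivrMr ?central_bin_gt0// mul1r ler_nat.
exact: bin_le_central.
Qed.

(** The bound is the value of the kernel at 0, that is, the sum of its
    coefficients. *)
Lemma wiener_multiplier_le M N H : (0 < M)%N ->
  wiener (multiplier M N H) <= 4 ^+ N / 'C(N.*2, N)%:R :> R.
Proof.
move=> M0; rewrite /wiener /multiplier big_allpairs_dep /fst.
rewrite (eq_bigr (fun=> (\sum_(l <- sidelobes N)
   'C(N.*2, l)%:R / 'C(N.*2, N)%:R) / M%:R)); last first.
  move=> i _; rewrite mulr_suml; apply: eq_bigr => l _.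
  by rewrite cabs_real ger0_norm// !mulr_ge0 ?invr_ge0.
rewrite big_const_seq count_predT size_iota iter_addr_0 -[X in X <= _]mulr_natr.
rewrite divfK ?pnatr_eq0 -?lt0n//.
rewrite -mulr_suml ler_wpM2r ?invr_ge0//.
rewrite /sidelobes big_filter.
apply: (@le_trans _ _ (\sum_(l <- iota 0 N.*2.+1) 'C(N.*2, l)%:R)).
  by rewrite [leLHS]big_mkcond; apply: ler_sum => l _; case: ifP.
rewrite -[iota _ _]/(index_iota 0 N.*2.+1) big_mkord.
have -> : 4 ^+ N = (1 + 1) ^+ N.*2 :> R.
  by rewrite -muln2 mulnC exprM; congr (_ ^+ _); ring.
by rewrite exprDn; apply: ler_sum => l _; rewrite !expr1n mulr1.
Qed.

(** The dilated kernel K_N (n x). *)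
Definition peak N n x : R := 4 ^+ N / 'C(N.*2, N)%:R * cosbump n x ^+ N.

Lemma trig_multiplier M N H x : (0 < M)%N ->
  1 + trig (multiplier M N H) x =
  ((M%:R^-1 * \sum_(i < M) peak N (lacunary N H i) x)%:C)%C.
Proof.
move=> M0; rewrite /trig /multiplier big_allpairs_dep /fst /snd.
have MM : (M%:R : R) != 0 by rewrite pnatr_eq0 -lt0n.
have CC : ('C(N.*2, N)%:R : R) != 0 by rewrite gt_eqF ?central_bin_gt0.
have Nl : (N < N.*2.+1)%N by lia.
have e i : \sum_(l <- sidelobes N)
     (('C(N.*2, l)%:R / 'C(N.*2, N)%:R / M%:R)%:C)%C *
       expix ((lacunary N H i)%:Z * (l%:Z - N%:Z)) x =
    (M%:R^-1)%:C%C * ((peak N (lacunary N H i) x)%:C%C - 1).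
  rewrite /peak mulrAC [in RHS]rmorphM /= -sum_bin_expix.
  rewrite (bigD1 (Ordinal Nl))//= subrr mulr0 expix0 mulr1 mulrDl.
  have -> : 'C(N.*2, N)%:R * (('C(N.*2, N)%:R^-1)%:C)%C = 1 :> R[i].
    rewrite -[X in X * _](rmorph_nat (@real_complex R)) -rmorphM /=.
    by rewrite divff.
  rewrite [1 + _]addrC addrK [RHS]mulrC /sidelobes big_filter -[iota _ _]/(index_iota 0 N.*2.+1) big_mkord.
  rewrite -mulrA mulr_suml; apply: eq_bigr => l _.
  rewrite -[in RHS](rmorph_nat (@real_complex R)).
  rewrite [RHS]mulrAC; congr (_ * _); rewrite -!rmorphM /=; congr (_%:C)%C.
  by rewrite mulrA.
have -> : iota 0 M = index_iota 0 M by rewrite /index_iota subn0.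
rewrite big_mkord.
under eq_bigr do rewrite e.
rewrite -mulr_sumr sumrB sumr_const card_ord mulrBr -rmorph_sum /= -rmorphM /=.
have -> : (M%:R^-1)%:C%C * M%:R = 1 :> R[i].
  by rewrite -[X in _ * X](rmorph_nat (@real_complex R)) -rmorphM /= mulVf.
by rewrite addrC subrK.
Qed.

End multiplier.

(** * The approximation step *)
Section approximation_step.
Context {R : realType}.

Lemma bernoulli_1D (c : R) n : 0 <= c -> 1 + n%:R * c <= (1 + c) ^+ n.
Proof.
move=> c0; elim: n => [|n IH]; first by rewrite mul0r addr0 expr0.
rewrite exprS; apply: (@le_trans _ _ ((1 + c) * (1 + n%:R * c))); last first.
  by rewrite ler_wpM2l// addr_ge0.
have cc : 0 <= n%:R * (c * c) by rewrite !mulr_ge0.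
by rewrite -natr1; lra.
Qed.

(** With r = s ^ 2, one factor s ^ n absorbs n by Bernoulli's inequality and the
    other one tends to 0. *)
Lemma cvg_natM_geometric (r : R) : 0 < r < 1 ->
  (fun n : nat => n%:R * r ^+ n) @ \oo --> (0 : R).
Proof.
move=> /andP[r0 r1]; pose s := Num.sqrt r.
have s0 : 0 < s by rewrite sqrtr_gt0.
have s1 : s < 1 by rewrite -sqrtr1 ltr_sqrt.
have rs : r = s * s by rewrite -expr2 sqr_sqrtr// ltW.
pose c := s^-1 - 1; have c0 : 0 < c by rewrite subr_gt0 invf_gt1.
have bern n : n%:R * s ^+ n <= c^-1.
  have h : 1 + n%:R * c <= s ^- n.
    have -> : s ^- n = (1 + c) ^+ n by rewrite /c addrC subrK exprVn.
    by apply: bernoulli_1D; exact: ltW.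
  have sn : 0 < s ^+ n by rewrite exprn_gt0.
  rewrite -(ler_pM2r c0) mulVf ?gt_eqF// mulrAC -ler_pdivlMr// mul1r.
  by rewrite (le_trans _ h)// lerDr.
have cv : (fun n => c^-1 * s ^+ n) @ \oo --> (0 : R).
  rewrite -[X in _ --> X](mulr0 c^-1); apply: cvgMr.
  by apply: cvg_expr; rewrite ger0_norm ?ltW.
apply: (squeeze_cvgr _ (cvg_cst 0) cv); near=> n; apply/andP; split.
  by rewrite mulr_ge0// exprn_ge0// ltW.
rewrite rs exprMn mulrA ler_wpM2r ?bern// exprn_ge0// ltW//.
Unshelve. all: by end_near. Qed.

Lemma powR2_gt1 (a : R) : 0 < a -> 1 < 2 `^ a.
Proof.
move=> a0; have e : 1 `^ a = 1 :> R by rewrite powR1.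
by rewrite -[ltLHS]e; apply: gt0_ltr_powR; rewrite ?nnegrE ?ltr1n.
Qed.

(** The kernel will be K_N with N = (r t) ^ 2.  The width 1 / r is a small
    multiple of 1 / M, so that M exceptional sets of this measure are small
    together; the exponent t ^ 2 makes K_N tiny off the exceptional sets, and
    costs a factor t in its height.  As M = 2 ^ m and t = m, this factor is
    logarithmic in M. *)
Lemma exists_parameters (A delta eta eps q : R) :
  0 < A -> 0 < delta -> 0 < eta -> 0 < eps -> 2 < q ->
  exists M r t : nat, [/\ (0 < M)%N, (0 < r)%N & (0 < t)%N] /\
    [/\ M%:R * (4 * pi / r%:R) < delta,
        A * ((2 * (r * t))%:R / 2 ^+ (t ^ 2)) <= eta,
        A / M%:R <= 1 &
        (A / M%:R) `^ (q - 1) * (A * (2 * (r * t))%:R) <= eps].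
Proof.
move=> A0 delta0 eta0 eps0 q2.
pose B := (Num.truncn (4 * pi / delta)).+1.
have BE : 4 * pi / delta < B%:R by exact: truncnS_gt.
pose a := q - 2; have a0 : 0 < a by rewrite subr_gt0.
pose ra := (2 `^ a)^-1.
have ra01 : 0 < ra < 1.
  by rewrite /ra invr_gt0 powR_gt0//= invf_lt1 ?powR_gt0// powR2_gt1.
have h01 : 0 < (2^-1 : R) < 1 by lra.
have c1 := cvg_natM_geometric _ h01; have c2 := cvg_natM_geometric _ ra01.
pose K1 := 2 * A * B%:R; pose K2 := 2 * A ^+ 2 * A `^ a * B%:R.
have B0 : 0 < B%:R :> R by [].
have K10 : 0 < K1 by rewrite !mulr_gt0.
have K20 : 0 < K2 by rewrite !mulr_gt0 ?powR_gt0// exprn_gt0.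
have /cvgrPdist_le/(_ (eta / K1)) := c1 => /(_ (divr_gt0 eta0 K10)) e1.
have /cvgrPdist_le/(_ A^-1) := c1; rewrite invr_gt0 => /(_ A0) e3.
have /cvgrPdist_le/(_ (eps / K2)) := c2 => /(_ (divr_gt0 eps0 K20)) e2.
near \oo => m.
have m2 : (2 <= m)%N by near: m; exact: nbhs_infty_ge.
have f1 : m%:R * 2^-1 ^+ m <= eta / K1.
  have : `|0 - m%:R * 2^-1 ^+ m| <= eta / K1 by near: m; exact: e1.
  by rewrite sub0r normrN ger0_norm// mulr_ge0// exprn_ge0.
have f3 : m%:R * 2^-1 ^+ m <= A^-1.
  have : `|0 - m%:R * 2^-1 ^+ m| <= A^-1 by near: m; exact: e3.
  by rewrite sub0r normrN ger0_norm// mulr_ge0// exprn_ge0.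
have f2 : m%:R * ra ^+ m <= eps / K2.
  have : `|0 - m%:R * ra ^+ m| <= eps / K2 by near: m; exact: e2.
  by rewrite sub0r normrN ger0_norm// mulr_ge0// exprn_ge0// invr_ge0 powR_ge0.
have M0 : 0 < 2 ^+ m :> R by rewrite exprn_gt0.
have ME : (2 ^ m)%:R = 2 ^+ m :> R by rewrite natrX.
exists (2 ^ m)%N, (B * 2 ^ m)%N, m; split.
  by split; [rewrite expn_gt0|rewrite muln_gt0 expn_gt0|exact: leq_trans m2].
split.
- rewrite natrM ME.
  have -> : 2 ^+ m * (4 * pi / (B%:R * 2 ^+ m)) = 4 * pi / B%:R :> R.
    by field; rewrite !gt_eqF.
  by rewrite ltr_pdivrMr// -ltr_pdivrMl// [ltLHS]mulrC.
- rewrite ler_pdivlMr// mulrC in f1.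
  rewrite (le_trans _ f1)// /K1 !natrM ME.
  have -> : 2 * A * B%:R * (m%:R * 2^-1 ^+ m) = A * (2 * (B%:R * m%:R) / 2 ^+ m).
    by rewrite exprVn; field; rewrite gt_eqF.
  rewrite ler_pM2l//.
  have -> : 2 * (B%:R * 2 ^+ m * m%:R) / 2 ^+ (m ^ 2) =
      2 * (B%:R * m%:R) * (2 ^+ m / 2 ^+ (m ^ 2)) :> R by ring.
  have h : 2 ^+ m * 2 ^+ m <= 2 ^+ (m ^ 2)%N :> R.
    rewrite -exprD; apply: ler_weXn2l; first by rewrite ler1n.
    by rewrite addnn -mul2n expnS expn1 leq_mul2r m2 orbT.
  apply: ler_wpM2l; first by rewrite !mulr_ge0.
  by rewrite ler_pdivrMr ?exprn_gt0// ler_pdivlMl.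
- rewrite ME ler_pdivrMr// mul1r.
  rewrite exprVn ler_pdivrMr// in f3.
  have : 1 <= m%:R :> R by rewrite ler1n; exact: ltnW.
  by move=> /le_trans/(_ f3); rewrite mulrC ler_pdivlMr// mul1r.
- rewrite ler_pdivlMr// in f2; rewrite (le_trans _ f2)// ME !natrM ME.
  have -> : q - 1 = a + 1 by rewrite /a; ring.
  have AM : A / 2 ^+ m != 0 by rewrite gt_eqF// divr_gt0.
  rewrite powRD; last by rewrite AM implybT.
  rewrite powRr1 ?(divr_ge0 (ltW A0) (ltW M0))// powRM ?invr_ge0 ?(ltW A0) ?(ltW M0)//.
  have -> : (2 ^+ m)^-1 `^ a = ra ^+ m.
    rewrite -powR_invn// -powR_mulrn ?invr_ge0 ?powR_ge0// /ra -powRN -!powRrM.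
    by congr (_ `^ _); ring.
  rewrite /K2 le_eqVlt; apply/orP; left; apply/eqP.
  by field; rewrite gt_eqF.
Unshelve. all: by end_near. Qed.

(** Off the exceptional set of [cosbump_large_measure] the kernel is small:
    its exponent is t ^ 2 times the one of that lemma. *)
Lemma peak_le n r t (x : R) : (0 < r)%N -> (0 < t)%N ->
  cosbump n x ^+ (r ^ 2)%N < 2^-1 ->
  0 <= peak ((r * t) ^ 2) n x <= (2 * (r * t))%:R / 2 ^+ (t ^ 2)%N.
Proof.
move=> r0 t0 xr; rewrite /peak; set N := ((r * t) ^ 2)%N.
have cx := @cosbump_ge0 R n x.
have C0 := @central_bin_gt0 R N.
rewrite mulr_ge0 ?exprn_ge0 ?divr_ge0 ?exprn_ge0//=.
apply: ler_pM; rewrite ?exprn_ge0 ?divr_ge0 ?exprn_ge0//.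
  rewrite ler_pdivrMr// -natrX -natrM ler_nat mulnC.
  by apply: central_bin_sqr_exp_ge; rewrite muln_gt0 r0.
rewrite /N expnMn exprM -exprVn.
by apply: lerXn2r; rewrite ?nnegrE ?exprn_ge0// ltW.
Qed.

Lemma freq_shift_gt (L D : nat) (a b : int) :
  ((L + D).+1 <= `|a|)%N -> (`|b| <= D)%N -> (L < `|(a + b)%R|)%N.
Proof. by lia. Qed.

(** Multiply by the average of 1 - K_N over M dilations.  Averaging divides the
    coefficients by M, while their l^1 norm is at most a multiple of K_N (0),
    which is M up to a logarithmic factor. *)
Lemma approximation_step (s : seq (R[i] * int)) (L : nat) (delta eta eps q : R) :
  0 < delta -> 0 < eta -> 0 < eps -> 2 < q ->
  exists u : seq (R[i] * int),
    [/\ forall p, p \in u -> (L < `|p.2|)%N,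
        forall k, cabs (coef u k) <= 1,
        forall X, uniq X -> \sum_(k <- X) cabs (coef u k) `^ q <= eps &
        (lebesgue_measure
          (@period R `&` [set x | eta < cabs (trig s x - trig u x)]%R)
           < delta%:E)%E].
Proof.
move=> delta0 eta0 eps0 q2.
pose A := wiener s + 1; have A0 : 0 < A by rewrite ltr_wpDl// wiener_ge0.
have sA : wiener s <= A by rewrite lerDl.
have [M [r [t [[M0 r0 t0] [Mdelta Aeta AM Aeps]]]]] :=
  exists_parameters A delta eta eps q A0 delta0 eta0 eps0 q2.
pose N := ((r * t) ^ 2)%N.
pose D := \max_(p <- s) `|p.2|%N; pose H := (L + D).+1.
pose u := trig_scale (-1) (trig_mul (multiplier M N H) s).
have H0 : (0 < H)%N by [].
have M0' : 0 < M%:R :> R by rewrite ltr0n.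
have uAM k : cabs (coef u k) <= A / M%:R.
  have -> : coef u k = - coef (trig_mul (multiplier M N H) s) k.
    rewrite /u /coef /trig_scale big_map /= -sumrN.
    by apply: eq_bigr => p _; rewrite mulN1r.
  rewrite cabsN (@le_trans _ _ (M%:R^-1 * wiener s))//.
    apply: cabs_coef_mul_le; first by rewrite invr_ge0.
      exact: multiplier_freq_uniq.
    by move=> p; exact: multiplier_coef_le.
  by rewrite mulrC ler_wpM2r// invr_ge0.
have wu : wiener u <= A * (2 * (r * t))%:R.
  rewrite /u wiener_scale cabsN cabs1 mul1r wiener_mul mulrC.
  apply: ler_pM => //; rewrite ?wiener_ge0//.
  apply: (le_trans (@wiener_multiplier_le R _ _ _ M0)).
  rewrite ler_pdivrMr ?central_bin_gt0// -natrX -natrM ler_nat mulnC.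
  by apply: central_bin_sqr_exp_ge; rewrite muln_gt0 r0.
exists u; split.
- move=> p; rewrite /u /trig_scale => /mapP[p' /allpairsP[[a b] /=] [am bs ->] ->] /=.
  apply: (freq_shift_gt _ D _ _ (multiplier_freq_ge _ _ _ _ H0 am)).
  by apply: (@leq_bigmax_seq _ s xpredT (fun p => `|p.2|%N)).
- by move=> k; rewrite (le_trans (uAM k)).
- move=> X uX; have q1 : 1 <= q by lra.
  rewrite (le_trans (sum_powR_coef_le _ _ _ _ uX q1 uAM))// (le_trans _ Aeps)//.
  by rewrite ler_wpM2l ?powR_ge0.
pose B i := @period R `&` [set x | 2^-1 <= cosbump (lacunary N H i) x ^+ (r ^ 2)%N].
have mB i : measurable (B i).
  by apply: measurable_fun_le => //; [exact: measurable_period|exact: measurable_cosbumpX].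
have mG : measurable (@period R `&` [set x | eta < cabs (trig s x - trig u x)]).
  apply: measurable_gt; first exact: measurable_period.
  have -> : (fun x => cabs (trig s x - trig u x)) =
      (fun x => cabs (trig (s ++ trig_scale (-1) u) x)).
    by apply/funext => x; rewrite trig_cat trig_scaleE mulN1r.
  exact: measurable_cabs_trig.
apply: (@le_lt_trans _ _ (lebesgue_measure (\big[setU/set0]_(i < M) B i))).
  apply: le_measure; rewrite ?inE//; first by apply: bigsetU_measurable => i _; exact: mB.
  move=> x [px /=]; apply: contraPP => nB; apply/negP; rewrite -leNgt.
  have small i : (i < M)%N -> cosbump (lacunary N H i) x ^+ (r ^ 2)%N < 2^-1.
    move=> iM; rewrite ltNge; apply/negP => h; apply: nB.
    by rewrite (bigD1 (Ordinal iM))//=; left.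
  have -> : trig s x - trig u x = trig s x * (1 + trig (multiplier M N H) x).
    by rewrite /u trig_scaleE trig_mulE; ring.
  rewrite trig_multiplier// cabsM cabs_real.
  apply: (le_trans _ Aeta); apply: ler_pM; rewrite ?cabs_ge0//.
    exact: le_trans (cabs_trig_le _ _) sA.
  have pk i : (i < M)%N -> 0 <= peak N (lacunary N H i) x <= (2 * (r * t))%:R / 2 ^+ (t ^ 2)%N.
    by move=> iM; apply: peak_le => //; exact: small.
  rewrite ger0_norm; last first.
    rewrite mulr_ge0 ?invr_ge0// sumr_ge0// => i _.
    by have /andP[] := pk i (ltn_ord i).
  rewrite ler_pdivrMl//.
  apply: (@le_trans _ _ (\sum_(i < M) (2 * (r * t))%:R / 2 ^+ (t ^ 2)%N)).
    by apply: ler_sum => i _; have /andP[] := pk i (ltn_ord i).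
  by rewrite sumr_const card_ord [leRHS]mulr_natl.
have bo := @Boole_inequality _ _ _ (@lebesgue_measure R) B M (fun i _ => mB i).
apply: (le_lt_trans bo).
apply: (@le_lt_trans _ _ (\sum_(i < M) (4 * pi / r%:R)%:E)%E).
  apply: lee_sum => i _; apply: cosbump_large_measure => //.
  by rewrite /lacunary muln_gt0 expn_gt0.
by rewrite sumEFin lte_fin sumr_const card_ord -[ltLHS]mulr_natl.
Qed.

End approximation_step.

(** * Weights and exceptional sets *)

Lemma exists_lt_of_cvge0 (R : realType) (v : nat -> \bar R) (e : R) :
  (v n @[n --> \oo] --> 0)%E -> 0 < e -> exists n, (v n < e%:E)%E.
Proof.
move=> /fine_cvgP[fin /cvgrPdist_lt c] e0; have [N _ HN] := filterI fin (c _ e0).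
exists N; have [fN] := HN N (leqnn _).
rewrite sub0r normrN => /(le_lt_trans (ler_norm _)) h.
by rewrite -(fineK fN) lte_fin.
Qed.

(** The weight is 1 / (1 + v), v being the sum over n >= n0 of b n / e n times
    the indicator of B n.  On the n-th exceptional set it is at most
    e n / (e n + b n), which compensates for the size of h n there.  By the
    Borel-Cantelli lemma v is finite almost everywhere; where it is not, fine
    gives it the value 0, so that the weight is positive everywhere. *)
Lemma weight_of_small_exceptions d (T : measurableType d) (R : realType)
    (m : {measure set T -> \bar R}) (D : set T) (h : nat -> T -> R)
    (b e : nat -> R) (B : nat -> set T) :
  measurable D -> (m D < +oo)%E ->
  (forall n, measurable (B n) /\ B n `<=` D) ->
  (\sum_(n <oo) m (B n) < +oo)%E ->
  (forall n, measurable_fun D (h n)) ->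
  (forall n x, 0 <= h n x <= b n) ->
  (forall n x, D x -> ~ B n x -> h n x <= e n) ->
  (forall n, 0 < e n) -> e @ \oo --> (0 : R) ->
  forall eps : R, 0 < eps -> exists mu : T -> R,
    [/\ measurable_fun D mu, forall x, 0 < mu x <= 1,
        (m [set x | D x /\ (mu x != 1)%R] < eps%:E)%E &
        (\int[m]_(x in D) (h n x * mu x)%:E @[n --> \oo] --> 0)%E].
Proof.
move=> mD mDfin mB sB mh hb he e0 ecv eps eps0.
have b0 n : 0 <= b n.
  have [[x _]|T0] := pselect (exists x : T, True).
    by have /andP[h0] := hb n x; exact: le_trans.
  by exfalso; apply: T0; exists point.
have [n0 hn0] : exists n0, (\sum_(n0 <= n <oo) m (B n) < eps%:E)%E.
  apply: exists_lt_of_cvge0 eps0.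
  exact: (@nneseries_tail_cvg R (fun n => m (B n)) xpredT sB (fun n _ => measure_ge0 _ _)).
pose G i := if (n0 <= i)%N then b i / e i else 0.
have G0 i : 0 <= G i by rewrite /G; case: ifP => // _; rewrite divr_ge0// ltW.
pose g i x := (G i * \1_(B i) x)%:E.
have g0 i x : (0 <= g i x)%E by rewrite lee_fin mulr_ge0.
pose v x : \bar R := (\sum_(i <oo) g i x)%E.
have v0 x : (0 <= v x)%E by apply: nneseries_ge0.
have fv0 x : 0 <= fine (v x) by apply: fine_ge0.
have mv : measurable_fun setT v.
  apply: (@ge0_emeasurable_sum _ _ _ _ _ xpredT) => // i _.
  apply/measurable_EFinP; apply: measurable_funM => //.
  by apply: measurable_indic; case: (mB i).
have mfv : measurable_fun setT (fun x => (1 + fine (v x))^-1).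
  have -> : (fun x => (1 + fine (v x))^-1) = (fun x => (1 + fine (v x)) `^ (-1)).
    by apply/funext => x; rewrite powR_inv1// addr_ge0.
  apply: (measurableT_comp (f := @powR R ^~ (-1))); first exact: measurable_powR.
  apply: measurable_funD => //.
  by apply: (measurableT_comp (f := @fine R)) => //; exact: fine_measurable.
exists (fun x => (1 + fine (v x))^-1).
have mu01 x : 0 < (1 + fine (v x))^-1 <= 1.
  have p : 0 < 1 + fine (v x) by rewrite ltr_pwDl.
  by rewrite invr_gt0 p /= invf_le1// lerDl fv0.
have exc x : (forall n, (n0 <= n)%N -> ~ B n x) -> v x = 0%E.
  move=> nB; rewrite /v eseries0// => i _ _; rewrite /g /G.
  case: ifPn => [/nB xB|_]; last by rewrite mul0r.
  by rewrite indicE memNset// mulr0.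
have vinf x : v x = +oo%E -> lim_sup_set B x.
  move=> vx n _; apply: contrapT => nB.
  have : (v x < +oo)%E.
    rewrite /v (@nneseries_split _ _ 0 n)//= add0n eseries0 ?adde0.
      by rewrite sumEFin ltry.
    move=> i ni _; rewrite /g indicE memNset ?mulr0// => Bi; apply: nB; by exists i.
  by rewrite vx ltxx.
have limB0 : m (lim_sup_set B) = 0%E.
  by apply: lim_sup_set_cvg0 => // k; case: (mB k).
have mlim : measurable (lim_sup_set B).
  by apply: bigcap_measurable => // k _; apply: bigcup_measurable => j _; case: (mB j).
split => //.
- exact: measurable_funTS.
- apply: le_lt_trans hn0; apply: measure_sigma_subadditive_tail.
  + by move=> n; case: (mB n).
  + have m1 : measurable_fun D (fun=> 1 : R) by [].
    have := measurable_fun_eqr (measurable_funTS mfv) m1.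
    move=> /(_ mD [set false] I).
    set A := _ `&` _; suff -> : [set x | D x /\ (1 + fine (v x))^-1 != 1] = A by [].
    by apply/funext => x; apply/propext; split => -[Dx /= h1]; split => //=; [exact: negbTE|exact: negbT].
  + move=> x [Dx mx]; apply: contrapT => nB; move: mx; rewrite exc ?addr0 ?invr1 ?eqxx//.
    by move=> n nn Bn; apply: nB; exists n => //=; apply/negP; rewrite -leqNgt.
have ple n : (n0 <= n)%N ->
    (\int[m]_(x in D) (h n x * (1 + fine (v x))^-1)%:E <= (e n)%:E * m D)%E.
  move=> nn; rewrite -integral_cst//.
  have hm0 x : (0 <= (h n x * (1 + fine (v x))^-1)%:E)%E.
    rewrite lee_fin mulr_ge0//; first by have /andP[] := hb n x.
    by have /andP[/ltW] := mu01 x.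
  apply: ae_ge0_le_integral => //.
  + by apply/measurable_EFinP; apply: measurable_funM => //; exact: measurable_funTS.
  + by move=> x _; rewrite lee_fin ltW.
  exists (lim_sup_set B); split => // x /= nle; apply: vinf; apply: contrapT => vx.
  apply: nle => Dx; rewrite lee_fin; have /andP[h0 hbx] := hb n x.
  have [Bx|nBx] := pselect (B n x); last first.
    have /andP[mu0 mu1] := mu01 x.
    by rewrite (le_trans _ (he _ _ Dx nBx))// ler_piMr.
  have Gv : G n <= fine (v x).
    rewrite -lee_fin fineK; last by rewrite ge0_fin_numE// ltey; apply/eqP.
    have -> : (G n)%:E = g n x by rewrite /g indicE mem_set// mulr1.
    rewrite /v (@nneseries_split _ _ 0 n.+1)//= add0n big_nat_recr//=.
    by rewrite -addeA addeCA leeDl// adde_ge0 ?sume_ge0 ?nneseries_ge0.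
  rewrite ler_pdivrMr; last by rewrite ltr_pwDl.
  rewrite (le_trans hbx)//; rewrite /G nn in Gv.
  apply: (@le_trans _ _ (e n * (1 + b n / e n))).
    by rewrite mulrDr mulr1 mulrCA divff ?gt_eqF// mulr1 lerDr ltW.
  by rewrite ler_wpM2l ?lerD2l// ltW.
have cv0 : ((e n)%:E * m D @[n --> \oo] --> 0)%E.
  have mDf : m D \is a fin_num by rewrite ge0_fin_numE.
  rewrite -(mul0e (m D)); apply: cvgeMr => //.
  by apply: cvg_EFin => //; exact: nearW.
apply: (squeeze_cvge _ (cvg_cst 0%E) cv0).
exists n0 => // n /= nn; rewrite ple// andbT.
apply: integral_ge0 => x Dx; rewrite lee_fin mulr_ge0//.
  by have /andP[] := hb n x.
by have /andP[/ltW] := mu01 x.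
Qed.

(** * The weighted seminorm *)
Section weighted_seminorm.
Context {R : realType}.
Implicit Types (f g : R -> R[i]) (mu : R -> R).

Definition cmeas f :=
  measurable_fun (@period R) (fun x => complex.Re (f x)) /\
  measurable_fun (@period R) (fun x => complex.Im (f x)).

Lemma cmeasD f g : cmeas f -> cmeas g -> cmeas (f + g).
Proof.
move=> [fr fi] [gr gi]; split; rewrite fctE.
  by under eq_fun do rewrite cReD; exact: measurable_funD.
by under eq_fun do rewrite cImD; exact: measurable_funD.
Qed.

Lemma cmeasN f : cmeas f -> cmeas (- f).
Proof.
move=> [fr fi]; split; rewrite fctE.
  by under eq_fun do rewrite cReN; exact: measurableT_comp.
by under eq_fun do rewrite cImN; exact: measurableT_comp.
Qed.

Lemma cmeasB f g : cmeas f -> cmeas g -> cmeas (f - g).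
Proof. by move=> mf mg; apply: cmeasD => //; exact: cmeasN. Qed.

Lemma cmeasZ (c : R[i]) f : cmeas f -> cmeas (fun x => c * f x).
Proof.
move=> [fr fi]; split.
  under eq_fun do rewrite cReM; apply: measurable_funB; exact: measurable_funM.
under eq_fun do rewrite cImM; apply: measurable_funD; exact: measurable_funM.
Qed.

Lemma cmeas_trig (s : seq (R[i] * int)) : cmeas (trig s).
Proof. by split; [exact: measurable_Re_trig|exact: measurable_Im_trig]. Qed.

Lemma cmeas_real (u : R -> R) : measurable_fun (@period R) u ->
  cmeas (fun x => (u x)%:C%C).
Proof. by []. Qed.

Lemma measurable_wnorm mu f : measurable_fun (@period R) mu -> cmeas f ->
  measurable_fun (@period R) (fun x => (cabs (f x) * mu x)%:E).
Proof.
move=> mmu [fr fi]; apply/measurable_EFinP; apply: measurable_funM => //.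
exact: measurable_cabs.
Qed.

Lemma wnorm_ge0 mu f : (forall x, period x -> 0 <= mu x) -> (0 <= wnorm mu f)%E.
Proof.
by move=> mu0; apply: integral_ge0 => x px; rewrite lee_fin mulr_ge0 ?cabs_ge0 ?mu0.
Qed.

Lemma le_wnorm mu mu' f g :
  measurable_fun (@period R) mu -> measurable_fun (@period R) mu' ->
  cmeas f -> cmeas g -> (forall x, period x -> 0 <= mu x) ->
  (forall x, period x -> cabs (f x) * mu x <= cabs (g x) * mu' x) ->
  (wnorm mu f <= wnorm mu' g)%E.
Proof.
move=> mmu mmu' mf mg mu0 fg; apply: ge0_le_integral.
- exact: measurable_period.
- by move=> x px; rewrite lee_fin mulr_ge0 ?cabs_ge0 ?mu0.
- exact: measurable_wnorm.
- exact: measurable_wnorm.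
- by move=> x px; rewrite lee_fin fg.
Qed.

Lemma wnormD mu f g :
  measurable_fun (@period R) mu -> cmeas f -> cmeas g ->
  (forall x, period x -> 0 <= mu x) ->
  (wnorm mu (f + g)%R <= wnorm mu f + wnorm mu g)%E.
Proof.
move=> mmu mf mg mu0; rewrite /wnorm -ge0_integralD.
- apply: ge0_le_integral.
  + exact: measurable_period.
  + by move=> x px; rewrite lee_fin mulr_ge0 ?cabs_ge0 ?mu0.
  + by apply: measurable_wnorm => //; exact: cmeasD.
  + by apply: emeasurable_funD; exact: measurable_wnorm.
  + by move=> x px; rewrite -EFinD lee_fin -mulrDl ler_wpM2r ?mu0// ler_cabsD.
- exact: measurable_period.
- by move=> x px; rewrite lee_fin mulr_ge0 ?cabs_ge0 ?mu0.
- exact: measurable_wnorm.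
- by move=> x px; rewrite lee_fin mulr_ge0 ?cabs_ge0 ?mu0.
- exact: measurable_wnorm.
Qed.

Lemma wnormN mu f : wnorm mu (- f) = wnorm mu f.
Proof. by rewrite /wnorm; apply: eq_integral => x _; rewrite fctE cabsN. Qed.

Lemma wnorm_triangle mu f g h :
  measurable_fun (@period R) mu -> cmeas f -> cmeas g -> cmeas h ->
  (forall x, period x -> 0 <= mu x) ->
  (wnorm mu (f - h)%R <= wnorm mu (f - g)%R + wnorm mu (g - h)%R)%E.
Proof.
move=> mmu mf mg mh mu0; have -> : f - h = (f - g) + (g - h) by rewrite addrA subrK.
by apply: wnormD => //; exact: cmeasB.
Qed.

Lemma wnormZ mu (c : R[i]) f :
  measurable_fun (@period R) mu -> cmeas f -> (forall x, period x -> 0 <= mu x) ->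
  (wnorm mu (fun x => c * f x)%R = (cabs c)%:E * wnorm mu f)%E.
Proof.
move=> mmu mf mu0; rewrite /wnorm -ge0_integralZl//.
- by apply: eq_integral => x _; rewrite cabsM -mulrA EFinM.
- exact: measurable_period.
- exact: measurable_wnorm.
- by move=> x px; rewrite lee_fin mulr_ge0 ?cabs_ge0 ?mu0.
- exact: cabs_ge0.
Qed.

Lemma wnorm_le_bound mu f (K : R) :
  measurable_fun (@period R) mu -> cmeas f ->
  (forall x, period x -> 0 <= mu x <= 1) -> (forall x, cabs (f x) <= K) ->
  (wnorm mu f <= (K * (2 * pi))%:E)%E.
Proof.
move=> mmu mf mu01 fK; rewrite EFinM -lebesgue_period -integral_cst; last first.
  exact: measurable_period.
apply: ge0_le_integral.
- exact: measurable_period.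
- by move=> x px; have /andP[m0 _] := mu01 x px; rewrite lee_fin mulr_ge0 ?cabs_ge0.
- exact: measurable_wnorm.
- exact: measurable_cst.
- move=> x px; have /andP[m0 m1] := mu01 x px.
  by rewrite lee_fin (le_trans _ (fK x))// ler_piMr ?cabs_ge0.
Qed.

End weighted_seminorm.

(** * Density of trigonometric polynomials *)
Section density.
Context {R : realType}.
Implicit Types (f g : R -> R[i]) (u : R -> R) (s t : seq (R[i] * int)).

(** Membership in the closure of the trigonometric polynomials in the unweighted
    space; this suffices for all weights, which are at most 1. *)
Definition trig_approx f := cmeas f /\ forall e : R, 0 < e ->
  exists s, (wnorm (cst 1%R) (f - trig s)%R < e%:E)%E.

Let m1 : measurable_fun (@period R) (cst (1 : R)). Proof. by []. Qed.
Let p1 : forall x : R, period x -> 0 <= (cst 1 x : R). Proof. by move=> x _; exact: ler01. Qed.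

Lemma trig_approx_lim f : cmeas f ->
  (forall e : R, 0 < e -> exists2 g, trig_approx g &
     (wnorm (cst 1%R) (f - g)%R < e%:E)%E) ->
  trig_approx f.
Proof.
move=> mf fg; split => // e e0; have e20 : 0 < e / 2 by rewrite divr_gt0.
have [g [mg gs] fge] := fg _ e20; have [s gse] := gs _ e20; exists s.
apply: (le_lt_trans (wnorm_triangle _ _ _ _ m1 mf mg (cmeas_trig s) p1)).
by rewrite [e]splitr EFinD lteD.
Qed.

Lemma trig_approx_trig s : trig_approx (trig s).
Proof.
split; first exact: cmeas_trig; move=> e e0; exists s.
rewrite subrr /wnorm integral0_eq// => x _.
by rewrite fctE cabs0 mul0r.
Qed.

Lemma trig_approxD f g : trig_approx f -> trig_approx g -> trig_approx (f + g).
Proof.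
move=> [mf fa] [mg ga]; split; first exact: cmeasD.
move=> e e0; have e20 : 0 < e / 2 by rewrite divr_gt0.
have [s fs] := fa _ e20; have [t gt] := ga _ e20; exists (s ++ t).
have -> : (f + g - trig (s ++ t) = (f - trig s) + (g - trig t))%R.
  by apply/funext => x; rewrite !fctE trig_cat opprD addrACA.
have ms := cmeas_trig s; have mt := cmeas_trig t.
apply: (le_lt_trans (wnormD _ _ _ m1 (cmeasB _ _ mf ms) (cmeasB _ _ mg mt) p1)).
by rewrite [e]splitr EFinD lteD.
Qed.

Lemma trig_approxZ (c : R[i]) f : trig_approx f -> trig_approx (fun x => c * f x).
Proof.
move=> [mf fa]; split; first exact: cmeasZ.
move=> e e0; have c0 : 0 < cabs c + 1 by rewrite ltr_wpDl ?cabs_ge0.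
have [s fs] := fa _ (divr_gt0 e0 c0); exists (trig_scale c s).
have -> : ((fun x => c * f x) - trig (trig_scale c s) =
    fun x => c * (f - trig s) x)%R.
  by apply/funext => x; rewrite !fctE trig_scaleE mulrBr.
have ms := cmeas_trig s.
rewrite (wnormZ _ _ _ m1 (cmeasB _ _ mf ms) p1).
apply: (@le_lt_trans _ _ ((cabs c + 1)%:E * wnorm (cst 1%R) (f - trig s)%R)%E).
  by rewrite lee_wpmul2r ?lee_fin ?lerDl// wnorm_ge0.
by rewrite -lte_pdivlMl// -EFinM mulrC.
Qed.

Lemma trig_approxB f g : trig_approx f -> trig_approx g -> trig_approx (f - g).
Proof.
move=> fa ga; have -> : f - g = f + (fun x => -1 * g x).
  by apply/funext => x; rewrite !fctE mulN1r.
by apply: trig_approxD => //; exact: trig_approxZ.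
Qed.

Lemma trig_approx_sum (I : Type) (r : seq I) (F : I -> R -> R[i]) :
  (forall i, trig_approx (F i)) -> trig_approx (fun x => \sum_(i <- r) F i x).
Proof.
move=> Fa; elim: r => [|i r IH].
  have -> : (fun x => \sum_(i <- [::]) F i x) = trig [::] :> (R -> R[i]).
    by apply/funext => x; rewrite big_nil /trig big_nil.
  exact: trig_approx_trig.
have -> : (fun x => \sum_(j <- i :: r) F j x) = F i + (fun x => \sum_(j <- r) F j x).
  by apply/funext => x; rewrite big_cons fctE.
exact: trig_approxD.
Qed.

Definition real_approx u := trig_approx (fun x => (u x)%:C%C).

Lemma wnorm_real u v : wnorm (cst 1%R) ((fun x => (u x)%:C%C) - (fun x => (v x)%:C%C))%R =
  (\int[@lebesgue_measure R]_(x in @period R) `|(u x)%:E - (v x)%:E|)%E.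
Proof.
apply: eq_integral => x _; rewrite fctE mulr1 -rmorphB cabs_real.
by rewrite -EFinB abse_EFin.
Qed.

Lemma real_approx_lim u (v : nat -> R -> R) : measurable_fun (@period R) u ->
  (forall n, real_approx (v n)) ->
  (\int[@lebesgue_measure R]_(x in @period R) `|(u x)%:E - (v n x)%:E|
     @[n --> \oo] --> 0)%E ->
  real_approx u.
Proof.
move=> mu va uv; apply: trig_approx_lim; first exact: cmeas_real.
move=> e e0; have [n hn] := exists_lt_of_cvge0 _ _ _ uv e0.
by exists (fun x => (v n x)%:C%C); [exact: va|rewrite wnorm_real].
Qed.

Lemma real_approx_dominated u (v : nat -> R -> R) (K : R) :
  measurable_fun (@period R) u -> (forall n, real_approx (v n)) ->
  (forall n x, `|v n x| <= K) ->
  {ae (@lebesgue_measure R), forall x, period x -> v n x @[n --> \oo] --> u x} ->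
  real_approx u.
Proof.
move=> mu va vK vu; apply: (real_approx_lim _ v) => //.
have [|||||] := @dominated_convergence _ _ _ (@lebesgue_measure R) (@period R)
  measurable_period (fun n x => (v n x)%:E) (fun x => (u x)%:E) (fun=> K%:E).
- by move=> n; apply/measurable_EFinP; have [[]] := va n.
- exact/measurable_EFinP.
- case: vu => N [mN N0 sN]; exists N; split => // x nx; apply: sN => vux; apply: nx => px.
  by apply: cvg_EFin; [exact: nearW|exact: vux].
- apply: (@measurable_bounded_integrable _ _ _ (@lebesgue_measure R) (cst K)) => //.
  + exact: measurable_period.
  + by move=> /=; rewrite [X in (X < _)%E]lebesgue_period ltry.
  + by exists `|K|; split; [exact: num_real|move=> y /ltW Ky x _].
- by apply: aeW => x n _; rewrite lee_fin.
move=> _ + _; apply: cvg_trans; apply: near_eq_cvg; apply: nearW => n /=.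
by apply: eq_integral => x _ /=; rewrite distrC.
Qed.

End density.

Section interval_indicators.
Context {R : realType}.
Implicit Types (u v : R -> R).

Definition rtrig u := exists s, forall x, trig s x = (u x)%:C%C.

Lemma rtrig_cst (c : R) : rtrig (fun=> c).
Proof. by exists [:: (c%:C%C, 0)] => x; rewrite trig_const. Qed.

Lemma rtrigD u v : rtrig u -> rtrig v -> rtrig (fun x => u x + v x).
Proof.
by move=> [s su] [t tv]; exists (s ++ t) => x; rewrite trig_cat su tv rmorphD.
Qed.

Lemma rtrigM u v : rtrig u -> rtrig v -> rtrig (fun x => u x * v x).
Proof.
by move=> [s su] [t tv]; exists (trig_mul s t) => x; rewrite trig_mulE su tv rmorphM.
Qed.

Lemma rtrigX u n : rtrig u -> rtrig (fun x => u x ^+ n).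
Proof.
move=> tu; elim: n => [|n IH]; first exact: (rtrig_cst 1).
by under eq_fun do rewrite exprS; exact: rtrigM.
Qed.

Lemma rtrig_cosB (c : R) : rtrig (fun x => cos (x - c)).
Proof.
exists [:: ((2^-1)%:C%C * expix 1 (- c), 1); ((2^-1)%:C%C * expix (-1) (- c), -1)].
move=> x; rewrite /trig !big_cons big_nil /= /expix.
rewrite !mul1r !mulN1r opprK !cosN !sinN cosB.
by apply/eqP; rewrite eq_complex /=; apply/andP; split; apply/eqP; field.
Qed.

Lemma real_approx_rtrig u : rtrig u -> real_approx u.
Proof.
move=> [s su]; rewrite /real_approx.
have -> : (fun x => (u x)%:C%C) = trig s by apply/funext => x; rewrite su.
exact: trig_approx_trig.
Qed.

Lemma bernoulli_1B (y : R) m : 0 <= y <= 1 -> 1 - m%:R * y <= (1 - y) ^+ m.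
Proof.
move=> /andP[y0 y1]; elim: m => [|m IH]; first by rewrite mul0r subr0 expr0.
rewrite exprS; apply: (@le_trans _ _ ((1 - y) * (1 - m%:R * y))); last first.
  by rewrite ler_wpM2l// subr_ge0.
rewrite -natr1; have : 0 <= m%:R * (y * y) by rewrite !mulr_ge0.
by lra.
Qed.

Lemma bernoulli_1BX_le (y : R) m : 0 <= y <= 1 -> (1 - y) ^+ m * (1 + m%:R * y) <= 1.
Proof.
move=> /andP[y0 y1]; apply: (@le_trans _ _ ((1 - y) ^+ m * (1 + y) ^+ m)).
  by rewrite ler_wpM2l ?exprn_ge0 ?subr_ge0// bernoulli_1D.
rewrite -exprMn exprn_ile1//; last by nra.
by rewrite mulr_ge0 ?subr_ge0// addr_ge0.
Qed.

(** The polynomials (1 - y ^ n) ^ (2 ^ n), used by Brosowski and Deutsch to prove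
    the Stone-Weierstrass theorem, tend to 1 for y < 1 / 2 and to 0 for
    y > 1 / 2. *)
Lemma cvg_brosowski_lt (y : R) : 0 <= y < 2^-1 ->
  (1 - y ^+ n) ^+ (2 ^ n)%N @[n --> \oo] --> (1 : R).
Proof.
move=> /andP[y0 y2].
have c1 : 1 - (2 * y) ^+ n @[n --> \oo] --> (1 : R).
  rewrite -[X in _ --> X]subr0; apply: cvgB; first exact: cvg_cst.
  by apply: cvg_expr; rewrite ger0_norm ?mulr_ge0//; lra.
apply: (squeeze_cvgr _ c1 (cvg_cst (1 : R))); near=> n.
have yn : 0 <= y ^+ n <= 1 by rewrite exprn_ge0 ?exprn_ile1//; lra.
have := bernoulli_1B _ (2 ^ n) yn; rewrite natrX -exprMn => -> /=.
by case/andP: yn => a b; rewrite exprn_ile1 ?subr_ge0 ?lerBlDr ?lerDl.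
Unshelve. all: by end_near. Qed.

Lemma cvg_brosowski_gt (y : R) : 2^-1 < y <= 1 ->
  (1 - y ^+ n) ^+ (2 ^ n)%N @[n --> \oo] --> (0 : R).
Proof.
move=> /andP[y2 y1].
have z0 : 0 < 2 * y by lra.
have c1 : (2 * y)^-1 ^+ n @[n --> \oo] --> (0 : R).
  by apply: cvg_expr; rewrite ger0_norm ?invr_ge0 ?(ltW z0)// invf_lt1//; lra.
apply: (squeeze_cvgr _ (cvg_cst (0 : R)) c1); near=> n.
have yn : 0 <= y ^+ n <= 1 by rewrite exprn_ge0 ?exprn_ile1//; lra.
have yn' := yn; case/andP: yn' => a b.
rewrite exprn_ge0 ?subr_ge0//= exprVn -[leRHS]mul1r ler_pdivlMr ?exprn_gt0//.
apply: le_trans (bernoulli_1BX_le _ (2 ^ n) yn).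
by rewrite natrX -exprMn ler_wpM2l ?exprn_ge0 ?subr_ge0// lerDr.
Unshelve. all: by end_near. Qed.

Lemma sin_mul_sin (x a b : R) :
  cos (x - (a + b) / 2) - cos ((b - a) / 2) =
  2 * (sin ((x - a) / 2) * sin ((b - x) / 2)).
Proof.
have -> : x - (a + b) / 2 = (x - a) / 2 - (b - x) / 2 by field.
have -> : (b - a) / 2 = (x - a) / 2 + (b - x) / 2 by field.
by rewrite cosB cosD; ring.
Qed.

Lemma sin_half_gt0 (y : R) : 0 < y < 2 * pi -> 0 < sin (y / 2).
Proof. by move=> y0; apply: sin_gt0_pi; lra. Qed.

Lemma sin_half_lt0 (y : R) : - (2 * pi) < y < 0 -> sin (y / 2) < 0.
Proof.
move=> y0; have -> : y / 2 = - (- y / 2) by field.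
by rewrite sinN oppr_lt0; apply: sin_half_gt0; lra.
Qed.

(** On [0, 2 pi], up to finitely many points, the trigonometric polynomial p
    below is less than 1 / 2 inside the interval and greater than 1 / 2 outside,
    by the factorization of [sin_mul_sin]; the polynomials of Brosowski and
    Deutsch turn it into the indicator. *)
Lemma real_approx_interval (a b : R) : real_approx (\1_(`]a, b]%classic : set R)).
Proof.
have [ba|ab] := leP b a.
  have -> : `]a, b]%classic = set0 :> set R.
    by rewrite set_itv_ge// bnd_simp -leNgt.
  rewrite indic0; exact: real_approx_rtrig (rtrig_cst 0).
have pi0 := @pi_gt0 R.
(* the signs of the two sines are known only for endpoints in [0, 2 pi] *)
pose clamp (y : R) := Num.max 0 (Num.min y (2 * pi)).
pose a' := clamp a; pose b' := clamp b.
pose p (x : R) := 2^-1 - 2^-1 ^+ 2 * (cos (x - (a' + b') / 2) - cos ((b' - a') / 2)).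
have pE x : p x = 2^-1 - 2^-1 * (sin ((x - a') / 2) * sin ((b' - x) / 2)).
  by rewrite /p sin_mul_sin; field.
have tp : rtrig p.
  rewrite (_ : p = fun x => 2^-1 + (- 2^-1 ^+ 2) * (cos (x - (a' + b') / 2) + - cos ((b' - a') / 2))).
    by apply: rtrigD; [exact: rtrig_cst|apply: rtrigM; [exact: rtrig_cst|
      by apply: rtrigD; [exact: rtrig_cosB|exact: rtrig_cst]]].
  by apply/funext => x; rewrite /p mulNr.
have p01 x : 0 <= p x <= 1.
  rewrite pE.
  have : `|sin ((x - a') / 2) * sin ((b' - x) / 2)| <= 1.
    by rewrite normrM mulr_ile1// sin_max.
  by rewrite ler_norml; lra.
pose q n (x : R) := (1 - p x ^+ n) ^+ (2 ^ n)%N.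
have tq n : rtrig (q n).
  rewrite /q; apply: rtrigX; apply: rtrigD; first exact: rtrig_cst.
  rewrite (_ : (fun x => - p x ^+ n) = fun x => -1 * p x ^+ n).
    by apply: rtrigM; [exact: rtrig_cst|exact: rtrigX].
  by apply/funext => x; rewrite mulN1r.
have q01 n x : `|q n x| <= 1.
  have /andP[p0 p1] := p01 x.
  rewrite ger0_norm /q; first by rewrite exprn_ile1 ?lerBlDr ?lerDl ?subr_ge0 ?exprn_ge0// exprn_ile1.
  by rewrite exprn_ge0// subr_ge0 exprn_ile1.
apply: (real_approx_dominated _ q 1) => //.
- by move=> n; exact: real_approx_rtrig.
pose N : set R := [set 0] `|` [set 2 * pi] `|` [set a] `|` [set b].
have mN : measurable N.
  by apply: measurableU => //; apply: measurableU => //; exact: measurableU.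
have N0 : lebesgue_measure N = 0%E.
  apply: countable_lebesgue_measure0; apply: finite_set_countable.
  by rewrite !finite_setU; do !split; exact: finite_set1.
exists N; split => // x; apply: contra_notP => nN.
rewrite /period /= in_itv /= => /andP[x0 x2pi].
have {}x0 : 0 < x.
  by rewrite lt_neqAle x0 andbT eq_sym; apply/eqP => h; apply: nN; left; left; left.
have {}x2pi : x < 2 * pi.
  by rewrite lt_neqAle x2pi andbT; apply/eqP => h; apply: nN; left; left; right.
have xa : x != a by apply/eqP => h; apply: nN; left; right.
have xb : x != b by apply/eqP => h; apply: nN; right.
have clampE y : x != y -> (clamp y < x) = (y < x) /\ (x < clamp y) = (x < y).
  move=> xy; rewrite /clamp gt_max x0 gt_min lt_max lt_min x2pi andbT.
  by rewrite [2 * pi < x]ltNge (ltW x2pi) orbF [x < 0]ltNge (ltW x0).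
have clamp_ge0 y : 0 <= clamp y by rewrite /clamp le_max lexx.
have clamp_le y : clamp y <= 2 * pi.
  by rewrite /clamp ge_max ge_min lexx orbT mulr_ge0// ltW.
have ab' : a' <= b'.
  rewrite /a' /b' /clamp ge_max le_max lexx/= le_max le_min !ge_min lexx (ltW ab).
  by rewrite !orbT.
have [a0 a2] := (clamp_ge0 a, clamp_le a); have [b0 b2] := (clamp_ge0 b, clamp_le b).
have [ea ea'] := clampE _ xa; have [eb eb'] := clampE _ xb.
rewrite -/a' in a0 a2 ea ea'; rewrite -/b' in b0 b2 eb eb'.
rewrite indicE mem_setE in_itv/=.
have [ax|xa'|axE] := ltgtP a x; last by rewrite axE eqxx in xa.
  have [bx|xb'|bxE] := ltgtP x b; last by rewrite bxE eqxx in xb.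
    apply: cvg_brosowski_lt; have /andP[-> _] := p01 x; rewrite pE.
    have s1 : 0 < sin ((x - a') / 2) by apply: sin_half_gt0; lra.
    have s2 : 0 < sin ((b' - x) / 2) by apply: sin_half_gt0; lra.
    by have := mulr_gt0 s1 s2; lra.
  apply: cvg_brosowski_gt; have /andP[_ ->] := p01 x; rewrite pE.
  have s1 : 0 < sin ((x - a') / 2) by apply: sin_half_gt0; lra.
  have s2 : sin ((b' - x) / 2) < 0 by apply: sin_half_lt0; lra.
  by have := nmulr_llt0 (sin ((x - a') / 2)) s2; rewrite s1; lra.
apply: cvg_brosowski_gt; have /andP[_ ->] := p01 x; rewrite pE.
have s1 : sin ((x - a') / 2) < 0 by apply: sin_half_lt0; lra.
have s2 : 0 < sin ((b' - x) / 2) by apply: sin_half_gt0; lra.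
by have := nmulr_rlt0 (sin ((b' - x) / 2)) s1; rewrite s2; lra.
Qed.

End interval_indicators.

Import HBSimple.

Section density_L1.
Context {R : realType}.
Implicit Types (u v : R -> R) (A B : set R) (mu : R -> R).

(** Dynkin's theorem, from intervals to measurable sets. *)
Lemma real_approx_indic A : measurable A -> real_approx (\1_A : R -> R).
Proof.
pose H : set (set R) := [set A | measurable A /\ real_approx (\1_A : R -> R)].
suff h : <<s setT, @ocitv R >> `<=` H by move=> mA; have [] := h A mA.
apply: lambda_system_subset.
- exact: ocitvI.
- split.
  + by move=> ? _; exact: subsetT.
  + split; first exact: measurableT.
    rewrite indicT; exact: real_approx_rtrig (rtrig_cst 1).
  + move=> A0 B BA [mA0 aA0] [mB aB]; split; first exact: measurableD.
    have -> : \1_(A0 `\` B) = (\1_A0 - \1_B : R -> R).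
      apply/funext => x; rewrite -[RHS]/(\1_A0 x - \1_B x) !indicE in_setD.
      have [xB|xB] /= := boolP (x \in B); last by rewrite andbT [RHS]subr0.
      by rewrite andbF (mem_set (BA _ (set_mem xB))) [RHS]subrr.
    have := trig_approxB _ _ aA0 aB; rewrite /real_approx.
    set f1 := (X in trig_approx X -> _); set f2 := (X in _ -> trig_approx X).
    suff -> : f1 = f2 by [].
    by apply/funext => x; rewrite /f1 /f2 !fctE rmorphB.
  + move=> F ndF HF.
    have mU : measurable (\bigcup_i F i) by apply: bigcup_measurable => i _; case: (HF i).
    split => //.
    apply: (real_approx_dominated _ (fun n => \1_(F n)) 1).
    * exact: measurable_indic.
    * by move=> n; case: (HF n).
    * by move=> n x; rewrite indicE normr_nat; case: (_ \in _).
    apply: aeW => x _.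
    have [[i _ Fx]|nFx] := pselect ((\bigcup_i F i) x).
      apply: cvg_near_cst.
      exists i => // n /= ni; rewrite !indicE !mem_set//; first by exists i.
      by move/subsetPset : (ndF _ _ ni); apply.
    apply: cvg_near_cst.
    exists 0%N => // n _; rewrite !indicE !memNset// => Fx; apply: nFx; by exists n.
- move=> _ [[a b] _ <-]; split; first exact: measurable_itv.
  exact: real_approx_interval.
- by move=> X _; exact: subsetT.
Qed.

Lemma real_approx_sfun (f : {sfun (measurableTypeR R) >-> R}) :
  real_approx (f : R -> R).
Proof.
rewrite /real_approx.
have -> : (fun x => (f x)%:C%C) =
    (fun x => \sum_(y <- finmap.enum_fset (fset_set (range f))) (y%:C%C * (\1_(f @^-1` [set y]) x)%:C%C)).
  apply/funext => x; rewrite [X in (X%:C)%C]fimfunE /= fsbig_finite//=.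
  by rewrite rmorph_sum; apply: eq_bigr => y _; rewrite rmorphM.
apply: trig_approx_sum => y; apply: trig_approxZ.
have mf : measurable (f @^-1` [set y]) by exact: (@measurable_funPTI _ _ (measurableTypeR R) R f [set y] (measurable_set1 y)).
exact: real_approx_indic mf.
Qed.

Lemma real_approx_bounded u (K : R) : measurable_fun (@period R) u ->
  (forall x, `|u x| <= K) -> real_approx u.
Proof.
move=> mu uK.
have iu : (@lebesgue_measure R).-integrable (@period R) (EFin \o u).
  apply: measurable_bounded_integrable => //.
  + exact: measurable_period.
  + by rewrite [X in (X < _)%E]lebesgue_period ltry.
  + by exists K; split; [exact: num_real|move=> y /ltW Ky x _; exact: le_trans Ky].
have [g [_ _ gu]] := @approximation_sfun_integrable _ _ R (@lebesgue_measure R) _ measurable_period _ iu.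
by apply: (real_approx_lim u g) => // n; exact: real_approx_sfun.
Qed.

Lemma ler_cabs_ReIm (z : R[i]) : cabs z <= `|complex.Re z| + `|complex.Im z|.
Proof.
rewrite -ler_sqr ?nnegrE ?cabs_ge0 ?addr_ge0// cabs_sqr sqrrD !real_normK ?num_real//.
by rewrite lerD2r lerDl mulrn_wge0// mulr_ge0.
Qed.

Lemma trig_approx_bounded (f : R -> R[i]) (K : R) : cmeas f ->
  (forall x, cabs (f x) <= K) -> trig_approx f.
Proof.
move=> [mr mi] fK.
have -> : f = (fun x => (complex.Re (f x))%:C%C) +
    (fun x => Complex 0 1 * (complex.Im (f x))%:C%C).
  apply/funext => x; rewrite [RHS]/(_ + _).
  by case: (f x) => a b; apply/eqP; rewrite eq_complex /=; apply/andP; split; apply/eqP; ring.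
apply: trig_approxD.
  apply: (real_approx_bounded _ K) => // x.
  exact: le_trans (ler_Re_cabs _) (fK x).
apply: (trig_approxZ _ (fun x => (complex.Im (f x))%:C%C)).
apply: (real_approx_bounded _ K) => // x.
exact: le_trans (ler_Im_cabs _) (fK x).
Qed.

(** The weight may degenerate, so that f need not be integrable; its truncations
    are, being bounded. *)
Lemma wL1_truncation mu (f : R -> R[i]) (e : R) :
  measurable_fun (@period R) mu -> (forall x, period x -> 0 <= mu x <= 1) ->
  wL1 mu f -> 0 < e ->
  exists g (K : R), [/\ cmeas g, forall x, cabs (g x) <= K &
    (wnorm mu (f - g)%R < e%:E)%E].
Proof.
move=> mmu mu01 [mr mi fi] e0.
pose A n := @period R `&` [set x | cabs (f x) <= n%:R].
have mA n : measurable (A n).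
  rewrite /A -preimage_itvNyc; apply: measurable_cabs mr mi _ _ _ => //.
  exact: measurable_period.
pose g n (x : R) : R[i] := (\1_(A n) x)%:C%C * f x.
have mg n : cmeas (g n).
  have mI : measurable_fun (@period R) (\1_(A n) : R -> R) by exact: measurable_indic.
  split; rewrite /g.
    under eq_fun do rewrite cReM /= mul0r subr0; exact: measurable_funM.
  under eq_fun do rewrite cImM /= mul0r addr0; exact: measurable_funM.
have gA n x : A n x -> g n x = f x by move=> Ax; rewrite /g indicE mem_set// mul1r.
have gnA n x : ~ A n x -> g n x = 0 by move=> Ax; rewrite /g indicE memNset// mul0r.
have mf : cmeas f by [].
have cf0 x : 0 <= cabs (f x) by exact: cabs_ge0.
have lim0 : (wnorm mu (f - g n)%R @[n --> \oo] --> 0)%E.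
  have [|||||_ _] := @dominated_convergence _ _ _ (@lebesgue_measure R) (@period R)
    measurable_period (fun n x => (cabs ((f - g n) x) * mu x)%:E) (cst 0%E)
    (fun x => (cabs (f x) * mu x)%:E).
  - by move=> n; apply: measurable_wnorm => //; exact: cmeasB.
  - exact: measurable_cst.
  - apply: aeW => x px; apply: cvg_near_cst.
    exists (Num.truncn (cabs (f x))).+1 => // n /= xn.
    rewrite -[(f - g n) x]/(f x - g n x) gA ?subrr ?cabs0 ?mul0r//; split => //=.
    rewrite (le_trans (ltW (truncnS_gt _)))// ler_nat//.
  - apply/integrableP; split; first exact: measurable_wnorm.
    rewrite (_ : (\int[_]_(_ in _) _)%E = wnorm mu f)//; apply: eq_integral => x.
    rewrite inE => px; have /andP[m0 _] := mu01 x px.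
    by rewrite gee0_abs// lee_fin mulr_ge0.
  - apply: aeW => x n px; have /andP[m0 _] := mu01 x px.
    rewrite gee0_abs ?lee_fin ?mulr_ge0 ?cabs_ge0// ler_wpM2r// -[(f - g n) x]/(f x - g n x).
    have [Ax|Ax] := pselect (A n x); first by rewrite gA// subrr cabs0.
    by rewrite gnA// subr0.
  by rewrite integral0_eq.
have [n hn] := exists_lt_of_cvge0 _ _ _ lim0 e0.
exists (g n), n%:R; split => // x.
have [[px Ax]|Ax] := pselect (A n x); last by rewrite gnA// cabs0.
by rewrite gA.
Qed.

(** Codes with rational coefficients form a countable type. *)
Definition ratlist (l : seq (rat * rat * int)) : seq (R[i] * int) :=
  [seq (Complex (ratr a.1.1) (ratr a.1.2), a.2) | a <- l].

Lemma rat_approx (x e : R) : 0 < e -> exists r : rat, `|x - ratr r| < e.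
Proof.
move=> e0; have [r] := @rat_in_itvoo R (x - e) (x + e) ltac:(lra).
by rewrite in_itv/= => /andP[h1 h2]; exists r; rewrite ltr_norml; lra.
Qed.

Lemma ratlist_approx (s : seq (R[i] * int)) (e : R) : 0 < e ->
  exists l, forall x, cabs (trig s x - trig (ratlist l) x) <= e.
Proof.
elim: s e => [|[c k] s IH] e e0.
  by exists [::] => x; rewrite /trig /ratlist !big_nil subr0 cabs0 ltW.
have e4 : 0 < e / 4 by rewrite divr_gt0.
have e2 : 0 < e / 2 by rewrite divr_gt0.
have [l hl] := IH _ e2.
have [r1 hr1] := rat_approx (complex.Re c) _ e4.
have [r2 hr2] := rat_approx (complex.Im c) _ e4.
exists ((r1, r2, k) :: l) => x; rewrite /trig /ratlist /= !big_cons /=.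
rewrite opprD addrACA -mulrBl (le_trans (ler_cabsD _ _))//.
rewrite cabsM cabs_expix mulr1.
have h : cabs (c - Complex (ratr r1) (ratr r2)) <= e / 2.
  rewrite (le_trans (ler_cabs_ReIm _))// cReD cImD cReN cImN /=.
  by rewrite (splitr (e / 2)) -mulrA -invfM -natrM lerD// ltW.
by rewrite (splitr e) lerD// (le_trans _ (hl x)).
Qed.

Lemma ratlist_dense mu (f : R -> R[i]) (e : R) :
  measurable_fun (@period R) mu -> (forall x, period x -> 0 <= mu x <= 1) ->
  wL1 mu f -> 0 < e ->
  exists l, (wnorm mu (f - trig (ratlist l))%R < e%:E)%E.
Proof.
move=> mmu mu01 fL e0; have e3 : 0 < e / 3 by rewrite divr_gt0.
have mu0 x : period x -> 0 <= mu x by move=> /mu01/andP[].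
have mf : cmeas f by case: fL.
have [g [K [mg gK fg]]] := wL1_truncation _ _ _ mmu mu01 fL e3.
have [_ /(_ _ e3)[s gs]] := trig_approx_bounded _ _ mg gK.
have pi2 : 0 < 2 * pi :> R by rewrite mulr_gt0// pi_gt0.
have e4 : 0 < e / 4 by rewrite divr_gt0.
have [l sl] := ratlist_approx s _ (divr_gt0 e4 pi2); exists l.
have ms := cmeas_trig s; have ml := cmeas_trig (ratlist l).
apply: (le_lt_trans (wnorm_triangle _ _ _ _ mmu mf mg ml mu0)).
have gs' : (wnorm mu (g - trig s)%R < (e / 3)%:E)%E.
  apply: le_lt_trans gs; apply: le_wnorm => //; try exact: cmeasB.
  by move=> x px; have /andP[m0 m1] := mu01 x px; rewrite ler_wpM2l ?cabs_ge0.
have sl' : (wnorm mu (trig s - trig (ratlist l))%R < (e / 3)%:E)%E.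
  apply: (le_lt_trans (wnorm_le_bound _ _ _ mmu (cmeasB _ _ ms ml) mu01 sl)).
  by rewrite divfK ?gt_eqF// lte_fin; lra.
have e3E : e%:E = ((e / 3)%:E + ((e / 3)%:E + (e / 3)%:E))%E.
  by rewrite -!EFinD; congr EFin; field.
rewrite e3E lteD//.
apply: (le_lt_trans (wnorm_triangle _ _ _ _ mmu mg ms ml mu0)).
by rewrite lteD.
Qed.

End density_L1.

(** * The universal series *)

Definition ratenum (n : nat) : seq (rat * rat * int) :=
  odflt [::] (unpickle (logn 2 n)).

(** Every list is enumerated infinitely often: the 2-adic valuation takes each
    value at arbitrarily large integers. *)
Lemma ratenum_frequent l N : exists2 n, (N <= n)%N & ratenum n = l.
Proof.
exists (2 ^ pickle l * N.*2.+1)%N.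
  have : (0 < 2 ^ pickle l)%N by rewrite expn_gt0.
  by set c := (2 ^ _)%N; nia.
rewrite /ratenum lognM ?expn_gt0// pfactorK// logn_coprime ?addn0 ?pickleK//.
by rewrite coprime2n /= odd_double.
Qed.

Section universal_series.
Context {R : realType}.
Implicit Types (k : int) (n : nat).

Definition dyadic n : R := 2^-1 ^+ n.+1.

Lemma dyadic_gt0 n : 0 < dyadic n. Proof. by rewrite exprn_gt0. Qed.

Lemma sum_dyadic_le n : \sum_(i < n) dyadic i <= 1.
Proof.
suff -> : \sum_(i < n) dyadic i = 1 - 2^-1 ^+ n by rewrite lerBlDr lerDl exprn_ge0.
elim: n => [|n IH]; first by rewrite big_ord0 expr0 subrr.
by rewrite big_ord_recr /= IH /dyadic exprS; field.
Qed.

Lemma cvg_dyadic : dyadic @ \oo --> (0 : R).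
Proof.
have h : `|2^-1 : R| < 1 by rewrite ger0_norm//; lra.
have := @cvg_geometric R 2^-1 _ h; rewrite /geometric /=.
by under eq_fun do rewrite -exprS.
Qed.

Definition exponent n : R := 2 + n.+1%:R^-1.

Lemma exponent_gt2 n : 2 < exponent n.
Proof. by rewrite ltrDl invr_gt0. Qed.

(** The n-th block approximates, in measure, the difference between the n-th
    rational trigonometric polynomial and the sum of the preceding blocks. *)
Lemma blocks_exist : exists u : nat -> seq (R[i] * int), exists L : nat -> nat,
  let s n := flatten [seq u i | i <- iota 0 n] in
  {homo L : i j / (i < j)%N >-> (i < j)%N} /\
  forall n, [/\ forall p, p \in u n -> (L n < `|p.2| <= L n.+1)%N,
    forall k, cabs (coef (u n) k) <= 1,
    forall X, uniq X -> \sum_(k <- X) cabs (coef (u n) k) `^ exponent n <= dyadic n &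
    (lebesgue_measure (@period R `&` [set x | dyadic n <
        cabs (trig (ratlist (ratenum n)) x - trig (s n.+1) x)]%R) < (dyadic n)%:E)%E].
Proof.
pose T := (seq (R[i] * int) * nat * nat)%type.
pose P (a : T) (v : seq (R[i] * int)) :=
    [/\ forall p, p \in v -> (a.1.2 < `|p.2|)%N,
        forall k, cabs (coef v k) <= 1,
        forall X, uniq X ->
          \sum_(k <- X) cabs (coef v k) `^ exponent a.2 <= dyadic a.2 &
        (lebesgue_measure (@period R `&` [set x | dyadic a.2 <
          cabs (trig (ratlist (ratenum a.2) ++ trig_scale (-1) a.1.1) x -
                trig v x)]%R) < (dyadic a.2)%:E)%E].
have exP a : exists v, P a v.
  exact: (approximation_step _ _ _ _ _ _ (dyadic_gt0 _) (dyadic_gt0 _) (dyadic_gt0 _)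
    (exponent_gt2 _)).
have [U hU] := choice exP.
pose step n (a : seq (R[i] * int) * nat) :=
  let u := U (a, n) in (a.1 ++ u, maxn a.2.+1 (\max_(p <- u) `|p.2|%N)).
pose st := fix st n := if n is m.+1 then step m (st m) else ([::], 0%N).
pose u n := U (st n, n); exists u, (fun n => (st n).2).
have sE n : flatten [seq u i | i <- iota 0 n] = (st n).1.
  elim: n => [//|n IH].
  by rewrite -addn1 iotaD map_cat flatten_cat IH add0n addn1 /= cats0.
split.
  apply: homo_ltn => [|n]; first exact: ltn_trans.
  by rewrite /= leq_max leqnn.
move=> n; have [h1 h2 h3 h4] := hU (st n, n); split => //.
- move=> p pu; apply/andP; split; first exact: h1.
  rewrite /= leq_max; apply/orP; right.
  exact: (@leq_bigmax_seq _ (u n) xpredT (fun p => `|p.2|%N)).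
- move: h4; rewrite sE; congr (lebesgue_measure (_ `&` _) < _)%E.
  apply/funext => x; congr (is_true (_ < cabs _)).
  rewrite trig_cat trig_scaleE mulN1r -addrA; congr (_ + _).
  by rewrite -opprD -trig_cat.
Qed.

End universal_series.

Section assembled_series.
Context {R : realType}.
Variables (u : nat -> seq (R[i] * int)) (L : nat -> nat).
Hypothesis L_incr : {homo L : i j / (i < j)%N >-> (i < j)%N}.
Hypothesis u_freq : forall n p, p \in u n -> (L n < `|p.2| <= L n.+1)%N.

Definition first_blocks n := flatten [seq u i | i <- iota 0 n].

(** The k-th coefficient is read off once the blocks have passed |k|. *)
Definition assembled (k : int) : R[i] := coef (first_blocks `|k|) k.

Lemma first_blocksS n : first_blocks n.+1 = first_blocks n ++ u n.
Proof. by rewrite /first_blocks -addn1 iotaD map_cat flatten_cat add0n /= cats0. Qed.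

Lemma L_ge n : (n <= L n)%N.
Proof. by elim: n => [//|n IH]; apply: leq_ltn_trans IH _; exact: L_incr. Qed.

Lemma L_homo i j : (i <= j)%N -> (L i <= L j)%N.
Proof. by rewrite leq_eqVlt => /predU1P[->//|/L_incr/ltnW]. Qed.

Lemma first_blocks_freq n p : p \in first_blocks n -> (`|p.2| <= L n)%N.
Proof.
elim: n => [//|n IH]; rewrite first_blocksS mem_cat => /orP[/IH h|/u_freq/andP[]//].
exact: leq_trans h (L_homo _ _ (leqnSn _)).
Qed.

Lemma coef_block_eq0 n k : (`|k| <= L n)%N -> coef (u n) k = 0.
Proof.
move=> kL; apply: coef_eq0 => p /u_freq /andP[h _].
by apply/eqP => pk; move: h; rewrite pk ltnNge kL.
Qed.

Lemma coef_first_blocks_eq0 n k : (L n < `|k|)%N -> coef (first_blocks n) k = 0.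
Proof.
move=> kL; apply: coef_eq0 => p /first_blocks_freq h.
by apply/eqP => pk; move: h; rewrite pk leqNgt kL.
Qed.

Lemma coef_first_blocks_stable n m k : (`|k| <= L n)%N -> (n <= m)%N ->
  coef (first_blocks m) k = coef (first_blocks n) k.
Proof.
move=> kL; elim: m => [|m IH]; first by rewrite leqn0 => /eqP ->.
rewrite leq_eqVlt => /predU1P[->//|nm].
rewrite first_blocksS coef_cat coef_block_eq0 ?addr0 ?IH//.
exact: leq_trans kL (L_homo _ _ (nm : (n <= m)%N)).
Qed.

Lemma coef_assembled n k : (`|k| <= L n)%N -> coef (first_blocks n) k = assembled k.
Proof.
move=> kL; rewrite /assembled; have [kn|/ltnW kn] := leqP `|k| n.
  by apply: coef_first_blocks_stable => //; exact: L_ge.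
by rewrite -(coef_first_blocks_stable _ _ _ kL kn).
Qed.

Lemma trig_psum_assembled n x : trig_psum assembled (L n) x = trig (first_blocks n) x.
Proof.
rewrite -(trig_psum_coef (first_blocks n) (L n)) => [|p]; last exact: first_blocks_freq.
by congr (_ x); apply: eq_trig_psum => k kL; rewrite coef_assembled.
Qed.

(** The blocks have disjoint spectra: for each k at most one term of the sum is
    nonzero. *)
Lemma powR_coef_first_blocks_le S k (q : R) : q != 0 ->
  cabs (coef (first_blocks S) k) `^ q <= \sum_(n < S) cabs (coef (u n) k) `^ q.
Proof.
move=> q0; elim: S => [|S IH].
  by rewrite big_ord0 /first_blocks /coef big_nil cabs0 powR0.
rewrite big_ord_recr /= first_blocksS coef_cat.
have [kL|kL] := leqP `|k| (L S).
  by rewrite coef_block_eq0// addr0 cabs0 powR0// addr0.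
by rewrite coef_first_blocks_eq0// add0r lerDr sumr_ge0// => n _; exact: powR_ge0.
Qed.

Hypothesis u_le1 : forall n k, cabs (coef (u n) k) <= 1.
Hypothesis u_lq : forall n X, uniq X ->
  \sum_(k <- X) cabs (coef (u n) k) `^ exponent n <= dyadic n.

Lemma powR_anti (a p q : R) : 0 <= a <= 1 -> 0 < p <= q -> a `^ q <= a `^ p.
Proof.
move=> /andP[a0 a1] /andP[p0 pq]; move: a0; rewrite le_eqVlt => /predU1P[<-|a0].
  by rewrite !powR0// gt_eqF// (lt_le_trans p0).
by apply: ger_powR; rewrite ?a0.
Qed.

Lemma sum_powR_block_le n X (q : R) : uniq X -> exponent n <= q ->
  \sum_(k <- X) cabs (coef (u n) k) `^ q <= dyadic n.
Proof.
move=> uX nq; apply: le_trans (u_lq n X uX); apply: ler_sum => k _.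
apply: powR_anti; first by rewrite cabs_ge0 u_le1.
by rewrite nq andbT (lt_trans _ (exponent_gt2 n)).
Qed.

Lemma sum_powR_block_le_wiener n X (q : R) : uniq X -> 1 <= q ->
  \sum_(k <- X) cabs (coef (u n) k) `^ q <= wiener (u n).
Proof.
move=> uX q1; apply: le_trans (sum_cabs_coef_le _ _ uX); apply: ler_sum => k _.
rewrite -[leRHS](powRr1 (cabs_ge0 _)); apply: powR_anti; last by rewrite ltr01.
by rewrite cabs_ge0 u_le1.
Qed.

(** The blocks with q_n <= q contribute at most the geometric series; there are
    finitely many others. *)
Lemma assembled_lq (q : R) : 2 < q ->
  (\esum_(k in [set: int]) (cabs (assembled k) `^ q)%:E < +oo)%E.
Proof.
move=> q2; pose n1 := Num.truncn ((q - 2)^-1).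
have n1P n : (n1 <= n)%N -> exponent n <= q.
  move=> nn; rewrite /exponent -lerBrDl invf_ple ?posrE ?subr_gt0//.
  by rewrite (le_trans (ltW (truncnS_gt _)))// ler_nat ltnS.
pose K := 1 + \sum_(n < n1) wiener (u n).
apply: (@le_lt_trans _ _ K%:E); last exact: ltry.
apply: ge_ereal_sup => _ [X [finX _] <-].
rewrite fsbig_finite//= sumEFin lee_fin.
set Y := finmap.enum_fset _; have uY : uniq Y by exact: finmap.fset_uniq.
pose S := \max_(k <- Y) `|k|%N.
have YS k : k \in Y -> (`|k| <= L S)%N.
  move=> kY; apply: leq_trans (L_ge S).
  exact: (@leq_bigmax_seq _ Y xpredT (fun k => `|k|%N)).
apply: (@le_trans _ _ (\sum_(k <- Y) \sum_(n < S) cabs (coef (u n) k) `^ q)).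
  rewrite big_seq [leRHS]big_seq; apply: ler_sum => k kY.
  by rewrite -(coef_assembled _ _ (YS _ kY)) powR_coef_first_blocks_le// gt_eqF//; lra.
rewrite exchange_big /=.
apply: (@le_trans _ _ (\sum_(n < S) (dyadic n + (if (n < n1)%N then wiener (u n) else 0)))).
  apply: ler_sum => n _; case: ltnP => [nn|nn]; last first.
    by rewrite addr0 sum_powR_block_le// n1P.
  apply: (@le_trans _ _ (wiener (u n))); last by rewrite lerDr ltW// dyadic_gt0.
  by apply: sum_powR_block_le_wiener => //; lra.
rewrite big_split /= lerD ?sum_dyadic_le//.
rewrite -big_mkcond /=.
have [Sn|nS] := leqP S n1.
  apply: (@le_trans _ _ (\sum_(n < S) wiener (u n))).
    by rewrite big_mkcond; apply: ler_sum => n _; case: ifP => // _; exact: wiener_ge0.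
  rewrite -(big_mkord xpredT (fun n => wiener (u n))).
  rewrite -(big_mkord xpredT (fun n => wiener (u n))).
  by rewrite (big_cat_nat _ Sn)//= lerDl sumr_ge0// => n _; exact: wiener_ge0.
by rewrite -(big_ord_widen _ (fun n => wiener (u n)) (ltnW nS)).
Qed.

Hypothesis u_approx : forall n,
  (lebesgue_measure (@period R `&` [set x | dyadic n <
     cabs (trig (ratlist (ratenum n)) x - trig (first_blocks n.+1) x)]%R) < (dyadic n)%:E)%E.

Lemma trig_psum_wL1 (mu : R -> R) (C : int -> R[i]) n : measurable_fun (@period R) mu ->
  (forall x, period x -> 0 <= mu x <= 1) -> wL1 mu (trig_psum C n).
Proof.
move=> mmu mu01.
have -> : trig_psum C n =
    trig [seq (C (j%:Z - n%:Z), j%:Z - n%:Z) | j <- iota 0 n.*2.+1].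
  by apply/funext => x; exact: trig_psumE.
split; [exact: measurable_Re_trig|exact: measurable_Im_trig|].
apply: le_lt_trans (ltry _).
exact: (wnorm_le_bound _ _ _ mmu (cmeas_trig _) mu01 (cabs_trig_le _)).
Qed.

Lemma assembled_weight (eps : R) : 0 < eps -> exists mu : R -> R,
  [/\ measurable_fun (@period R) mu, forall x, 0 < mu x <= 1,
      (lebesgue_measure [set x : R | period x /\ (mu x != 1)%R] < eps%:E)%E &
      (wnorm mu (trig (first_blocks n.+1) - trig (ratlist (ratenum n)))%R
         @[n --> \oo] --> 0)%E].
Proof.
move=> eps0.
pose t n := trig_scale (-1) (ratlist (ratenum n)) ++ first_blocks n.+1.
have tE n x : trig (t n) x = (trig (first_blocks n.+1) - trig (ratlist (ratenum n))) x.
  by rewrite /t trig_cat trig_scaleE mulN1r addrC.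
pose B n := @period R `&` [set x | dyadic n < cabs (trig (t n) x)].
have mB n : measurable (B n) /\ B n `<=` @period R.
  split; last by move=> x [].
  apply: measurable_gt; [exact: measurable_period|exact: measurable_cabs_trig].
have sB : (\sum_(n <oo) lebesgue_measure (B n) < +oo)%E.
  apply: (@le_lt_trans _ _ 1%:E); last exact: ltry.
  apply: le_trans (epsilon_trick0 xpredT ler01).
  apply: lee_nneseries => // n _; apply/ltW.
  have -> : 1 / (2 ^ n.+1)%N%:R = dyadic n :> R by rewrite /dyadic natrX exprVn div1r.
  apply: le_lt_trans (u_approx n); rewrite le_eqVlt; apply/orP; left; apply/eqP.
  congr (lebesgue_measure (_ `&` _)); apply/funext => x; congr (is_true (_ < _)).
  by rewrite tE -cabsN opprB.
have Dfin : (lebesgue_measure (@period R) < +oo)%E by rewrite lebesgue_period ltry.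
have := weight_of_small_exceptions _ _ _ (@lebesgue_measure R) (@period R)
  (fun n x => cabs (trig (t n) x)) (fun n => wiener (t n)) dyadic B
  measurable_period Dfin mB sB (fun n => measurable_cabs_trig _ _).
case/(_ _ _ dyadic_gt0 cvg_dyadic _ eps0).
- by move=> n x; rewrite cabs_ge0 cabs_trig_le.
- by move=> n x px nB; rewrite leNgt; apply/negP => h; apply: nB.
move=> mu [mmu mu01 mueps mucv]; exists mu; split => //.
apply: cvg_trans mucv; apply: near_eq_cvg; apply: nearW => n.
by apply: eq_integral => x _; rewrite tE.
Qed.

Lemma frequent_subsequence (P : nat -> nat -> Prop) :
  (forall k N, exists2 n, (N <= n)%N & P k n) ->
  exists m : nat -> nat, {homo m : i j / (i < j)%N >-> (i < j)%N} /\
    forall k, P k (m k).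
Proof.
move=> PN; have exP (a : nat * nat) : exists n, (a.2 <= n)%N /\ P a.1 n.
  by have [n] := PN a.1 a.2; exists n.
have [F hF] := choice exP.
pose m := fix m k := if k is j.+1 then F (k, (m j).+1) else F (0%N, 0%N).
exists m; split; last by case=> [|k]; [case: (hF (0%N, 0%N))|case: (hF (k.+1, (m k).+1))].
by apply: homo_ltn => [|k]; [exact: ltn_trans|case: (hF (k.+1, (m k).+1))].
Qed.

(** Approximate f by the terms g_(m k) of the enumeration, m increasing, and
    take the partial sums at the ends of the blocks m k. *)
Lemma assembled_universal (mu : R -> R) : measurable_fun (@period R) mu ->
  (forall x, 0 < mu x <= 1) ->
  (wnorm mu (trig (first_blocks n.+1) - trig (ratlist (ratenum n)))%R
     @[n --> \oo] --> 0)%E ->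
  universal_series (wL1 mu) (wnorm mu) (trig_psum assembled).
Proof.
move=> mmu mu01 mucv.
have mu01' x : period x -> 0 <= mu x <= 1.
  by move=> _; have /andP[/ltW -> ->] := mu01 x.
have mu0 x : period x -> 0 <= mu x by move=> /mu01'/andP[].
split=> [n|f fL]; first exact: trig_psum_wL1.
have mf : cmeas f by case: fL.
have [m [m_incr mP]] : exists m : nat -> nat,
    {homo m : i j / (i < j)%N >-> (i < j)%N} /\
    forall k, (wnorm mu (trig (ratlist (ratenum (m k))) - f)%R < (dyadic k)%:E)%E.
  apply: (frequent_subsequence
    (fun k n => (wnorm mu (trig (ratlist (ratenum n)) - f)%R < (dyadic k)%:E)%E)) => k N.
  have [l hl] := ratlist_dense _ _ _ mmu mu01' fL (dyadic_gt0 k).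
  have [n Nn nl] := ratenum_frequent l N; exists n => //.
  by rewrite nl -wnormN opprB.
exists (fun k => L (m k).+1); split; first by move=> i j ij; apply/L_incr/m_incr.
have m_ge k : (k <= m k)%N.
  by elim: k => [//|k IH]; apply: leq_ltn_trans IH _; exact: m_incr.
have c1 : (wnorm mu (trig (first_blocks (m k).+1) - trig (ratlist (ratenum (m k))))%R
    @[k --> \oo] --> 0)%E.
  apply: (cvg_comp m _ _ mucv) => A [N _ NA]; exists N => // k /= Nk.
  by apply: NA => /=; exact: leq_trans Nk (m_ge k).
have c2 : ((dyadic k : R)%:E @[k --> \oo] --> 0)%E.
  by apply: cvg_EFin; [exact: nearW|exact: cvg_dyadic].
have c3 : (wnorm mu (trig (first_blocks (m k).+1) - trig (ratlist (ratenum (m k))))%R +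
    (dyadic k)%:E @[k --> \oo] --> 0)%E.
  have d0 : (0 +? (0 : \bar R))%E by [].
  by have h := cvgeD d0 c1 c2; rewrite adde0 in h; exact: h.
apply: (squeeze_cvge _ (cvg_cst 0%E) c3); apply: nearW => k.
have -> : trig_psum assembled (L (m k).+1) = trig (first_blocks (m k).+1).
  by apply/funext => x; exact: trig_psum_assembled.
rewrite wnorm_ge0//=.
set s := first_blocks _; set r := ratlist _.
have := wnorm_triangle mu (trig s) (trig r) f mmu (cmeas_trig _) (cmeas_trig _) mf mu0.
move=> /le_trans; apply; rewrite leeD2l//; exact/ltW/mP.
Qed.

End assembled_series.

Theorem theorem1p5 (R : realType) :
  exists C : int -> R[i],
    (forall q : R, 2 < q ->
       (\esum_(k in [set: int]) (cabs (C k) `^ q)%:E < +oo)%E) /\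
    (forall eps : R, 0 < eps ->
       exists mu : R -> R,
         [/\ measurable_fun (@period R) mu,
             forall x, period x -> 0 < mu x <= 1,
             (lebesgue_measure [set x : R | period x /\ (mu x != 1)%R] < eps%:E)%E &
             universal_series (wL1 mu) (wnorm mu) (trig_psum C)]).
Proof.
have [u [L [L_incr uP]]] := @blocks_exist R.
have u_freq n p : p \in u n -> (L n < `|p.2| <= L n.+1)%N by case: (uP n) => + _ _ _; apply.
have u_le1 n k : cabs (coef (u n) k) <= 1 by case: (uP n).
exists (assembled u); split.
  by apply: (assembled_lq u L) => // n X uX; case: (uP n) => _ _ + _; apply.
move=> eps eps0.
have u_approx n := let: And4 _ _ _ h := uP n in h.
have [mu [mmu mu01 mueps mucv]] := assembled_weight u u_approx eps eps0.
exists mu; split => //.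
exact: (assembled_universal u L L_incr u_freq).
Qed.
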